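(* For every integer $k\ge2$ there exists $C>0$ such that, if $\rho:\mathbb N\to(0,1)$ satisfies $$\rho(l)\ \ge\ \frac{C\,l\,(2k-1)^{l/3}}{(2k-1)^{l}}$$ for all sufficiently large $l$, then asymptotically almost surely (as $l\to\infty$) a random $k$-generated group in the Gromov binomial model $\mathcal B(k,l,\rho)$ has Kazhdan's property (T).
   Context: Gromov binomial model $\mathcal B(k,l,\rho)$: fix a set of generators $\mathcal A$ with $|\mathcal A|=k$ and a function $\rho:\mathbb N\to(0,1)$. A random group is $\Gamma=\langle\mathcal A\mid R\rangle$, where $R$ is a random set of cyclically reduced words of length $l$ in the alphabet $\mathcal A\cup\mathcal A^{-1}$, each such word being included independently with probability $\rho(l)$. A property holds asymptotically almost surely if its probability tends to $1$ as $l\to\infty$. *)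

(* Defs.v *)
From HB Require Import structures.
From mathcomp Require Import all_boot all_order all_algebra.
From mathcomp Require Import complex.
From mathcomp Require Import all_classical all_reals all_analysis.
From mathcomp Require Import sesquilinear.

Set Implicit Arguments.
Unset Strict Implicit.
Unset Printing Implicit Defensive.

Import Order.TTheory GRing.Theory Num.Theory.
Import numFieldNormedType.Exports.

(* The letter (i, b) is the generator a_i when b = false and its formal
   inverse a_i^-1 when b = true. *)
Definition letter (k : nat) : finType := ('I_k * bool)%type.

Definition inv_letter (k : nat) (x : letter k) : letter k := (x.1, ~~ x.2).

Definition inv_word (k : nat) (w : seq (letter k)) : seq (letter k) :=
  rev (map (@inv_letter k) w).

(* [path.cycle] also compares the last letter with the first one. *)
Definition cyclically_reduced (k : nat) (w : seq (letter k)) : bool :=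
  path.cycle (fun x y => y != inv_letter x) w.

Definition relator (k l : nat) : finType :=
  {w : l.-tuple (letter k) | cyclically_reduced w}.

(* The congruence on words whose quotient is the group < a_1, ..., a_k | S >. *)
Inductive word_equiv (k : nat) (S : seq (letter k) -> Prop) :
    seq (letter k) -> seq (letter k) -> Prop :=
| word_equiv_refl u : word_equiv S u u
| word_equiv_sym u v : word_equiv S u v -> word_equiv S v u
| word_equiv_trans u v w :
    word_equiv S u v -> word_equiv S v w -> word_equiv S u w
| word_equiv_cat u u' v v' :
    word_equiv S u u' -> word_equiv S v v' -> word_equiv S (u ++ v) (u' ++ v')
| word_equiv_cancel x : word_equiv S [:: x; inv_letter x] [::]
| word_equiv_relator r : S r -> word_equiv S r [::].

Section PresentedGroup.
Variables (k : nat) (S : seq (letter k) -> Prop).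

Definition word_equivb (u v : seq (letter k)) : bool := `[< word_equiv S u v >].

Lemma word_equivb_is_equiv : equiv_class_of word_equivb.
Proof.
split=> [u|u v|v u w].
- exact/asboolP/word_equiv_refl.
- by apply/asboolP/asboolP; apply: word_equiv_sym.
- by move=> /asboolP uv /asboolP vw; apply/asboolP; apply: word_equiv_trans vw.
Qed.

Canonical word_equiv_rel : equiv_rel (seq (letter k)) :=
  EquivRelPack word_equivb_is_equiv.

Definition presented_group := {eq_quot word_equiv_rel}%qT.

HB.instance Definition _ := Choice.on presented_group.
HB.instance Definition _ := EqQuotient.on presented_group.

Lemma word_equivP (u v : seq (letter k)) :
  reflect (word_equiv S u v) (\pi_presented_group u == \pi_presented_group v)%qT.
Proof. by rewrite eqmodE; apply: asboolP. Qed.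

Lemma word_equiv_repr (u : seq (letter k)) :
  word_equiv S (repr (\pi_presented_group u)%qT) u.
Proof. by apply/word_equivP; rewrite reprK. Qed.

Lemma inv_letterK : involutive (@inv_letter k).
Proof. by case=> i b; rewrite /inv_letter /= negbK. Qed.

Lemma inv_wordK : involutive (@inv_word k).
Proof. by move=> w; rewrite /inv_word map_rev revK (mapK inv_letterK). Qed.

Lemma word_equiv_invl (w : seq (letter k)) : word_equiv S (inv_word w ++ w) [::].
Proof.
elim: w => [|x w IH]; first exact: word_equiv_refl.
rewrite /inv_word /= rev_cons -cats1 -catA.
apply: word_equiv_trans IH; apply: word_equiv_cat; first exact: word_equiv_refl.
apply: (@word_equiv_cat _ _ [:: inv_letter x; x] [::] w w); last first.
  exact: word_equiv_refl.
by rewrite -{2}[x]inv_letterK; apply: word_equiv_cancel.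
Qed.

Lemma word_equiv_invr (w : seq (letter k)) : word_equiv S (w ++ inv_word w) [::].
Proof. by rewrite -{1}[w]inv_wordK; apply: word_equiv_invl. Qed.

Lemma word_equiv_inv (u v : seq (letter k)) :
  word_equiv S u v -> word_equiv S (inv_word u) (inv_word v).
Proof.
move=> uv; apply: (@word_equiv_trans _ _ _ (inv_word u ++ (v ++ inv_word v))).
  apply: word_equiv_sym; rewrite -[X in word_equiv _ _ X]cats0.
  exact: word_equiv_cat (word_equiv_refl _ _) (word_equiv_invr v).
rewrite catA; apply: (@word_equiv_cat _ _ _ [::]) (word_equiv_refl _ _).
apply: word_equiv_trans (word_equiv_invl u).
exact: word_equiv_cat (word_equiv_refl _ _) (word_equiv_sym uv).
Qed.

Local Open Scope quotient_scope.

Definition presented_one : presented_group := \pi_presented_group [::].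

Definition presented_mul (x y : presented_group) : presented_group :=
  \pi_presented_group (repr x ++ repr y).

Definition presented_inv (x : presented_group) : presented_group :=
  \pi_presented_group (inv_word (repr x)).

Lemma presented_mul_pi (u v : seq (letter k)) :
  presented_mul (\pi_presented_group u) (\pi_presented_group v) =
  \pi_presented_group (u ++ v).
Proof.
by apply/eqP/word_equivP; apply: word_equiv_cat; apply: word_equiv_repr.
Qed.

Lemma presented_inv_pi (u : seq (letter k)) :
  presented_inv (\pi_presented_group u) = \pi_presented_group (inv_word u).
Proof. by apply/eqP/word_equivP/word_equiv_inv/word_equiv_repr. Qed.

Lemma presented_ind (P : presented_group -> Prop) :
  (forall u, P (\pi_presented_group u)) -> forall x, P x.
Proof. by move=> Pu x; rewrite -[x]reprK; apply: Pu. Qed.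

Lemma presented_mulA : associative presented_mul.
Proof.
elim/presented_ind=> u; elim/presented_ind=> v; elim/presented_ind=> w.
by rewrite !presented_mul_pi catA.
Qed.

Lemma presented_mul1 : left_id presented_one presented_mul.
Proof. by elim/presented_ind=> u; rewrite presented_mul_pi. Qed.

Lemma presented_mulr1 : right_id presented_one presented_mul.
Proof. by elim/presented_ind=> u; rewrite presented_mul_pi cats0. Qed.

Lemma presented_mulV : left_inverse presented_one presented_inv presented_mul.
Proof.
elim/presented_ind=> u; rewrite presented_inv_pi presented_mul_pi.
exact/eqP/word_equivP/word_equiv_invl.
Qed.

Lemma presented_mulrV : right_inverse presented_one presented_inv presented_mul.
Proof.
elim/presented_ind=> u; rewrite presented_inv_pi presented_mul_pi.
exact/eqP/word_equivP/word_equiv_invr.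
Qed.

HB.instance Definition _ := isGroup.Build presented_group
  presented_mulA presented_mul1 presented_mulr1 presented_mulV presented_mulrV.

End PresentedGroup.

Local Open Scope ring_scope.
Local Open Scope classical_set_scope.
Local Open Scope complex_scope.

(* The law of a random subset of T containing each t : T independently with
   probability p; see [binomial_prob_subset]. *)
Definition binomial_prob (R : realType) (T : finType) (p : R)
    (E : {set T} -> Prop) : R :=
  \sum_(A : {set T} | `[< E A >]) \prod_(t : T) (if t \in A then p else 1 - p).

Lemma binomial_prob_subset (R : realType) (T : finType) (p : R) (B : {set T}) :
  binomial_prob p (fun A : {set T} => B \subset A) = p ^+ #|B|.
Proof.
rewrite /binomial_prob.
transitivity (\prod_(t : T) (p + (if t \in B then 0 else 1 - p))).
  rewrite bigA_distr big_mkcond /=; apply: eq_bigr => A _.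
  rewrite asboolb; case: ifPn => [/fintype.subsetP BA|/subsetPn[t tB tA]].
    apply: eq_bigr => t _; case: ifPn => // tA.
    by case: ifP => // /BA; rewrite (negbTE tA).
  by rewrite (bigD1 t) //= (negbTE tA) tB mul0r.
rewrite (bigID (mem B)) /= [X in _ * X]big1 ?mulr1; last first.
  by move=> t /negbTE ->; rewrite addrC subrK.
by rewrite (eq_bigr (fun=> p)) ?prodr_const // => t ->; rewrite addr0.
Qed.

Definition random_group (k l : nat) (A : {set relator k l}) : groupType :=
  presented_group (fun w => exists2 r : relator k l, r \in A & w = val (val r)).

Definition gromov_binomial_prob (R : realType) (k l : nat) (p : R)
    (P : groupType -> Prop) : R :=
  binomial_prob p (fun A : {set relator k l} => P (random_group A)).

Record hilbertSpace (R : realType) := HilbertSpace {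
  hilbert_sort :> completeNormedModType R[i];
  inner : {dot hilbert_sort for Num.conj};
  innerE : forall v : hilbert_sort, inner v v = `|v| ^+ 2 }.

Record unitary_rep (R : realType) (G : groupType) (H : hilbertSpace R) :=
  UnitaryRep {
  rep_fun :> G -> {linear H -> H};
  rep1 : forall v, rep_fun 1%g v = v;
  repM : forall (g h : G) v, rep_fun (g * h)%g v = rep_fun g (rep_fun h v);
  rep_inner : forall (g : G) u v,
    inner H (rep_fun g u) (rep_fun g v) = inner H u v }.

(* The group is discrete, so its compact subsets are the finite ones. *)
Definition property_T (R : realType) (G : groupType) : Prop :=
  exists (Q : seq G) (eps : R), 0 < eps /\
    forall (H : hilbertSpace R) (pi : unitary_rep G H),
      (exists2 v : H, v != 0 & forall g, g \in Q ->
         `|pi g v - v| < eps%:C * `|v|) ->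
      exists2 v : H, v != 0 & forall g : G, pi g v = v.

(* Main.v *)
Require Import Defs.
From mathcomp Require Import all_boot all_order all_algebra.
From mathcomp Require Import complex ring lra zify.
From mathcomp Require Import all_classical all_reals all_analysis.
From mathcomp Require Import sesquilinear.

(** Let q = 2k - 1, and cut every relator of length l into words x, y, z whose
    lengths differ by at most one.  If v is a vector of a unitary representation
    and xyz = 1 in the group, then z v and y^-1 v are as far apart as x v and v.
    So consider the link: its vertices are the reduced words of the three
    lengths, and each relator contributes the edges z - y^-1, x - z^-1 and
    y - x^-1.  For the function f (w) = w v - v, the three edges of a relator have
    the same total squared length as the three vectors f (x), f (y), f (z)
    ([trivial_relator_energy]).  When the normalised Laplacian of the link has
    its spectrum above 1/2 apart from 0, comparing both sides bounds <Delta v, v>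
    by a multiple of |Delta v|^2, where Delta is the sum over the three lengths of
    1 minus the average over the sphere of reduced words ([link_gap],
    [laplacian_gap]).  This is the criterion of Zuk.  It gives property (T)
    without the spectral theorem: starting from an almost invariant vector, the
    descent u - Delta u / 6 converges geometrically to a nearby vector fixed by
    all reduced words of the three lengths ([gradient_descent]), and adding to it
    its image under a letter makes it invariant ([property_T_of_trace]).

    It remains to find the spectrum of the random link.  The number of words x
    that complete given y and z to a relator hardly depends on y and z
    ([path_count_bounds]), so the mean link is nearly the tripartite graph in
    which words are joined when their first letters differ.  The normalised
    adjacency operator of that graph has second eigenvalue 1/(2q), which leaves
    ample room below 1/2; the form needed is [tripartite_form].

    The deviation from the mean is a sum over all cyclically reduced words t of
    (1 - p or -p) times a fixed symmetric kernel.  The link has about q^(l/3)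
    vertices and degrees at least of order C l, that is, a large multiple of the
    logarithm of the number of vertices.  At this density the plainest moment
    method suffices.  The norm of a symmetric kernel is at most the n-th root of
    the trace of its n-th power ([kernel_form_le]), and the mean of that trace is
    a sum over closed walks in which no relator occurs exactly once.  Counting a
    new arc by the degree D, and a repeated one by the number of arcs already
    used, bounds the mean by a multiple of (const * n * D)^(n/2)
    ([expect_kernel_trace]).  With n of order l and D at least C l, this is
    exponentially smaller than the n-th power of a small multiple of D, and
    Markov's inequality concludes ([gromov_binomial_prob_ge]). *)

Set Implicit Arguments.
Unset Strict Implicit.
Unset Printing Implicit Defensive.

Import Order.TTheory GRing.Theory Num.Theory.
Import numFieldNormedType.Exports.

Local Open Scope ring_scope.

(** * Sums over tuples *)

Section TupleSums.
Variables (V : nmodType) (I : finType).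

Lemma sum_tuple0 (F : seq I -> V) : \sum_(w : 0.-tuple I) F w = F [::].
Proof.
rewrite (big_pred1 [tuple]) // => w; apply/esym/eqP/val_inj; by case: w => -[].
Qed.

Lemma sum_tuple_cons n (F : seq I -> V) :
  \sum_(w : n.+1.-tuple I) F w = \sum_x \sum_(w : n.-tuple I) F (x :: w).
Proof.
rewrite pair_big /=.
rewrite (reindex (fun p : I * n.-tuple I => [tuple of p.1 :: p.2])) //=.
exists (fun w : n.+1.-tuple I => (thead w, [tuple of behead w])) => [[x w] _|w _] /=.
  by rewrite theadE; congr (_, _); apply: val_inj.
by apply: val_inj; rewrite /= [in RHS](tuple_eta w).
Qed.

Lemma sum_tuple_cat a b (F : seq I -> V) :
  \sum_(w : (a + b).-tuple I) F w =
  \sum_(x : a.-tuple I) \sum_(y : b.-tuple I) F (x ++ y).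
Proof.
elim: a F => [|a IH] F.
  by rewrite (sum_tuple0 (fun x => \sum_(y : b.-tuple I) F (x ++ y))).
rewrite (sum_tuple_cons (a + b)).
rewrite (sum_tuple_cons a (fun x => \sum_(y : b.-tuple I) F (x ++ y))).
by apply: eq_bigr => x _; rewrite (IH (fun w => F (x :: w))).
Qed.

End TupleSums.

(** * Moments of independent centred Bernoulli variables *)

Section BernoulliMoments.
Variables (R : realFieldType) (T : finType) (p : R).

Definition subset_weight (A : {set T}) : R :=
  \prod_(t : T) (if t \in A then p else 1 - p).

Definition expect (F : {set T} -> R) : R := \sum_A F A * subset_weight A.

Definition centred (A : {set T}) (t : T) : R := (t \in A)%:R - p.

(** Distributing the product over all t turns it into the sum over subsets. *)
Lemma expect_prod (g : T -> bool -> R) :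
  expect (fun A => \prod_t g t (t \in A)) =
  \prod_t (p * g t true + (1 - p) * g t false).
Proof.
rewrite bigA_distr; apply: eq_bigr => A _; rewrite /subset_weight -big_split /=.
by apply: eq_bigr => t _; case: ifP => _; rewrite mulrC.
Qed.

Lemma subset_weight_sum : \sum_A subset_weight A = 1.
Proof.
have := @expect_prod (fun _ _ => 1).
rewrite [in RHS]big1 => [<-|t _]; last by ring.
by apply: eq_bigr => A _; rewrite big1 ?mul1r.
Qed.

Hypothesis p01 : 0 < p < 1.

Lemma subset_weight_ge0 A : 0 <= subset_weight A.
Proof.
case/andP: p01 => p0 p1; apply: prodr_ge0 => t _; case: ifP => _; lra.
Qed.

(** The first moment vanishes; from the second on, the moments are controlled by
    the variance p (1 - p). *)
Lemma central_moment_le n : (2 <= n)%N ->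
  `|p * (1 - p) ^+ n + (1 - p) * (- p) ^+ n| <= p.
Proof.
case/andP: p01 => p0 p1 n2.
have q0 : 0 <= 1 - p by lra.
apply: le_trans (ler_normD _ _) _; rewrite !normrM !normrX normrN.
rewrite (gtr0_norm p0) (ger0_norm q0).
have h1 : (1 - p) ^+ n <= (1 - p) ^+ 2 by apply: ler_wiXn2l => //; lra.
have h2 : p ^+ n <= p ^+ 2 by apply: ler_wiXn2l => //; lra.
have := ler_wpM2l (ltW p0) h1; have := ler_wpM2l q0 h2.
move=> h3 h4; apply: le_trans (lerD h4 h3) _; nra.
Qed.

(** By independence the mean factors over the values occurring in s.  A value
    occurring once contributes 0, and any other one at most p in absolute value,
    so the mean can be nonzero only if there are at most half as many values as
    factors. *)
Lemma expect_prod_centred (s : seq T) :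
  `|expect (fun A => \prod_(t <- s) centred A t)| <=
  (if ((size (undup s)).*2 <= size s)%N then p ^+ size (undup s) else 0).
Proof.
case/andP: p01 => p0 p1.
have -> : expect (fun A => \prod_(t <- s) centred A t) =
   \prod_t (p * (1 - p) ^+ count_mem t s + (1 - p) * (- p) ^+ count_mem t s).
  transitivity (expect (fun A => \prod_t centred A t ^+ count_mem t s)); last first.
    rewrite (expect_prod (fun t b => (b%:R - p) ^+ count_mem t s)).
    by apply: eq_bigr => t _; rewrite sub0r.
  apply: eq_bigr => A _; congr (_ * _).
  elim: s => [|x s IH]; first by rewrite big_nil big1.
  rewrite big_cons IH (bigD1 x) //= [in RHS](bigD1 x) //= eqxx exprS mulrA.
  congr (_ * _); apply: eq_bigr => t /negbTE tx.
  by rewrite eq_sym tx.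
rewrite normr_prod.
have [/hasP[t ts /eqP t1]|/hasPn no1] := boolP (has (fun t => count_mem t s == 1%N) s).
  rewrite (bigD1 t) //= t1 !expr1.
  have -> : p * (1 - p) + (1 - p) * - p = 0 by ring.
  by rewrite normr0 mul0r; case: ifP => // _; apply: exprn_ge0; apply: ltW.
have cnt t : t \in s -> (2 <= count_mem t s)%N.
  move=> ts; have := no1 t ts; have : (0 < count_mem t s)%N by rewrite -has_count has_pred1.
  by case: (count _ s) => [|[|]].
have szle : ((size (undup s)).*2 <= size s)%N.
  rewrite -[X in (_ <= X)%N](perm_size (perm_count_undup s)) size_flatten /shape -map_comp.
  rewrite sumnE big_map (eq_bigr (fun t => count_mem t s)); last first.
    by move=> t _; rewrite /= size_nseq.
  rewrite -muln2 -count_predT -sum1_count big_distrl /=.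
  by rewrite big_seq [X in (_ <= X)%N]big_seq; apply: leq_sum => t; rewrite mem_undup => /cnt.
rewrite szle (bigID (mem s)) /= [X in _ * X]big1 ?mulr1; last first.
  move=> t /count_memPn ->; rewrite !expr0 !mulr1.
  by rewrite addrC subrK normr1.
have -> : p ^+ size (undup s) = \prod_(t in s) p.
  rewrite prodr_const; congr (_ ^+ _).
  by rewrite -(card_uniqP (undup_uniq s)); apply: eq_card => t; rewrite mem_undup.
apply: ler_prod => t ts; rewrite normr_ge0 /=.
exact/central_moment_le/cnt.
Qed.

End BernoulliMoments.

(** * Powers of kernels and walks *)

Section Kernels.
Variables (R : comNzRingType) (V : finType).

Fixpoint kernel_pow (N : V -> V -> R) n : V -> V -> R :=
  if n is n'.+1 then fun u v => \sum_w N u w * kernel_pow N n' w v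
  else fun u v => (u == v)%:R.

Definition kernel_trace (N : V -> V -> R) : R := \sum_v N v v.

Variable N : V -> V -> R.

Lemma kernel_powD m n u v :
  kernel_pow N (m + n) u v = \sum_w kernel_pow N m u w * kernel_pow N n w v.
Proof.
elim: m u => [|m IH] u /=.
  rewrite (bigD1 u) //= eqxx mul1r big1 ?addr0 // => w /negbTE.
  by rewrite eq_sym => ->; rewrite mul0r.
under eq_bigr do rewrite IH big_distrr /=.
rewrite exchange_big; apply: eq_bigr => w _; rewrite big_distrl /=.
by apply: eq_bigr => z _; rewrite mulrA.
Qed.

Lemma kernel_pow1 u v : kernel_pow N 1 u v = N u v.
Proof.
rewrite /= (bigD1 v) //= eqxx mulr1 big1 ?addr0 // => w /negbTE ->.
by rewrite mulr0.
Qed.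

Lemma kernel_pow_sym n : (forall u v, N u v = N v u) ->
  forall u v, kernel_pow N n u v = kernel_pow N n v u.
Proof.
move=> Nsym; elim: n => [|n IH] u v; first by rewrite /= eq_sym.
rewrite -{2}addn1 kernel_powD /=; apply: eq_bigr => w _.
by rewrite -[X in _ = _ * X]/(kernel_pow N 1 w u) kernel_pow1 mulrC IH Nsym.
Qed.

End Kernels.

Section Walks.
Variables (R : realFieldType) (T J V : finType) (src tgt : T -> J -> V).

Local Notation arc := (T * J)%type.

Definition consecutive (x y : arc) : bool := tgt x.1 x.2 == src y.1 y.2.

Fixpoint walk (u : V) (s : seq arc) (v : V) : bool :=
  if s is x :: s' then (src x.1 x.2 == u) && walk (tgt x.1 x.2) s' v else u == v.

(** The weighted adjacency kernel of a multigraph whose arcs are labelled by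
    pairs in T * J: all the arcs over one t share the same random variable. *)
Definition arc_kernel (a : arc -> R) (u v : V) : R :=
  \sum_(x : arc) (if (src x.1 x.2 == u) && (tgt x.1 x.2 == v) then a x else 0).

Lemma kernel_pow_walks (a : arc -> R) n u v :
  kernel_pow (arc_kernel a) n u v =
  \sum_(s : n.-tuple arc) (walk u s v)%:R * \prod_(x <- s) a x.
Proof.
elim: n u => [|n IH] u.
  by rewrite (sum_tuple0 (fun s : seq arc => (walk u s v)%:R * \prod_(x <- s) a x))
             big_nil mulr1.
rewrite (sum_tuple_cons n (fun s : seq arc => (walk u s v)%:R * \prod_(x <- s) a x)) /=.
under eq_bigr => w _.
  rewrite /arc_kernel big_distrl /=.
  under eq_bigr do rewrite IH.
  over.
rewrite exchange_big; apply: eq_bigr => x _ /=.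
rewrite (bigD1 (tgt x.1 x.2)) //= eqxx andbT [X in _ + X]big1 ?addr0; last first.
  by move=> w /negbTE; rewrite eq_sym => ->; rewrite andbF mul0r.
rewrite big_distrr /=; apply: eq_bigr => s _; rewrite big_cons.
by case: ifP => _; rewrite ?mul0r //= mulrCA.
Qed.

Lemma walk_sorted u s v : walk u s v -> sorted consecutive s.
Proof.
elim: s u => // x [|y s] IH u //= /andP[_ /andP[/eqP xy ws]].
by rewrite /consecutive xy eqxx; apply: (IH (src y.1 y.2)); rewrite /= eqxx.
Qed.

(** A closed walk determines its base point, and being closed may be forgotten:
    only consecutiveness of the arcs is kept. *)
Lemma sum_walk_le (s : seq arc) : (0 < size s)%N ->
  \sum_v (walk v s v)%:R <= (sorted consecutive s)%:R :> R.
Proof.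
case: s => // x s _.
set b := sorted _ _; rewrite (bigD1 (src x.1 x.2)) //= [X in _ + X]big1 ?addr0; last first.
  by move=> v /negbTE; rewrite eq_sym => ->.
rewrite ler_nat -[_ && _]/(walk (src x.1 x.2) (x :: s) (src x.1 x.2)).
by case: (boolP (walk _ _ _)) => // /walk_sorted; rewrite -/b => ->.
Qed.

Variables (y D : R) (M : nat).
Hypothesis y0 : 0 <= y.
Hypothesis in_degree : forall v, (#|[set x : arc | tgt x.1 x.2 == v]|%:R * y <= D).

Definition support (s : seq arc) : seq T := undup [seq x.1 | x <- s].

(** An arc preceding a given walk either lies over a new element of T, at a cost
    y for each of the arcs ending at the right vertex, or reuses one of the at
    most M elements already met. *)
Lemma sum_supports_cons (s : seq arc) : (0 < size s)%N -> (size s <= M)%N ->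
  \sum_x (sorted consecutive (x :: s))%:R * y ^+ size (support (x :: s)) <=
  (D + (#|J| * M)%:R) * ((sorted consecutive s)%:R * y ^+ size (support s)).
Proof.
case: s => // z s _ sM; set s' := z :: s.
have E x : (sorted consecutive (x :: s'))%:R * y ^+ size (support (x :: s')) <=
  ((if tgt x.1 x.2 == src z.1 z.2 then y else 0) + (x.1 \in support s')%:R) *
   ((sorted consecutive s')%:R * y ^+ size (support s')).
  set b := sorted consecutive s'.
  have -> : sorted consecutive (x :: s') = consecutive x z && b by [].
  have -> : size (support (x :: s')) =
      (if x.1 \in support s' then size (support s') else (size (support s')).+1).
    by rewrite {1}/support map_cons /= mem_undup; case: ifP.
  have h : 0 <= b%:R * y ^+ size (support s') by rewrite mulr_ge0 ?ler0n ?exprn_ge0.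
  rewrite /consecutive; case: eqP => _ /=; last first.
    by rewrite mul0r add0r mulr_ge0 ?ler0n.
  case: ifP => _; first by rewrite mulrDl mul1r lerDr mulr_ge0.
  by rewrite addr0 exprS mulrCA.
apply: le_trans (ler_sum _ (fun x _ => E x)) _.
rewrite -big_distrl /=; apply: ler_wpM2r; first by rewrite mulr_ge0 ?ler0n ?exprn_ge0.
rewrite big_split /=; apply: lerD.
  rewrite -big_mkcond /= sumr_const.
  rewrite -mulr_natl; apply: le_trans (in_degree (src z.1 z.2)); apply: ler_wpM2r => //.
  by rewrite ler_nat; apply/eq_leq/eq_card => x; rewrite !inE.
rewrite -natr_sum ler_nat.
rewrite -(pair_big xpredT xpredT (fun t j => (t \in support s') : nat)) /=.
under eq_bigr do rewrite sum_nat_const.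
rewrite -big_distrr /= leq_mul //.
rewrite (eq_bigr (fun i => if i \in support s' then 1 else 0)%N); last first.
  by move=> i _; case: ifP.
rewrite -big_mkcond /= sum1_card; apply: leq_trans (card_size _) _.
by apply: leq_trans (size_undup _) _; rewrite size_map.
Qed.

Lemma sum_supports n : (n < M)%N ->
  \sum_(s : n.+1.-tuple arc) (sorted consecutive s)%:R * y ^+ size (support s) <=
  (#|T| * #|J|)%:R * y * (D + (#|J| * M)%:R) ^+ n.
Proof.
have D0 : 0 <= D + (#|J| * M)%:R \/ #|{: arc}| = 0%N.
  case: (pickP (mem {: arc})) => [x _|e]; last by right; apply: eq_card0.
  left; apply: addr_ge0 => //; apply: le_trans (in_degree (tgt x.1 x.2)).
  by rewrite mulr_ge0.
elim: n => [|n IH] nM.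
  rewrite (sum_tuple_cons 0 (fun s => (sorted consecutive s)%:R * y ^+ size (support s))).
  rewrite (eq_bigr (fun _ => y)) => [|x _]; last first.
    by rewrite (sum_tuple0 (fun s => (sorted consecutive (x :: s))%:R
         * y ^+ size (support (x :: s)))) /= mul1r.
  by rewrite sumr_const expr0 mulr1 -card_prod mulr_natl; apply: lexx.
rewrite (sum_tuple_cons n.+1 (fun s => (sorted consecutive s)%:R * y ^+ size (support s))).
rewrite exchange_big /=.
have step : \sum_(w : n.+1.-tuple arc) \sum_x
     (sorted consecutive (x :: w))%:R * y ^+ size (support (x :: w)) <=
   (D + (#|J| * M)%:R) * \sum_(w : n.+1.-tuple arc)
     (sorted consecutive w)%:R * y ^+ size (support w).
  rewrite big_distrr /=; apply: ler_sum => w _.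
  by apply: sum_supports_cons; rewrite size_tuple // ltnW.
apply: le_trans step _; case: D0 => [D0|c0].
  apply: le_trans (ler_wpM2l D0 (IH (ltnW nM))) _.
  by rewrite mulrCA exprS.
rewrite -card_prod c0 !mul0r.
rewrite (sum_tuple_cons n (fun s => (sorted consecutive s)%:R * y ^+ size (support s))).
by rewrite (big_pred0 _ _ _ _ (card0_eq c0)) mulr0.
Qed.

End Walks.

(** * The mean trace of a power of a random kernel *)

Section TraceMoment.
Variables (R : realFieldType) (T J V : finType) (src tgt : T -> J -> V).
Variables (c : J -> R) (p : R).
Hypothesis c1 : forall j, `|c j| <= 1.
Hypothesis p01 : 0 < p < 1.

Definition random_kernel (A : {set T}) : V -> V -> R :=
  arc_kernel src tgt (fun x : T * J => c x.2 * centred p A x.1).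

Lemma expectZ k F : expect p (fun A : {set T} => k * F A) = k * expect p F.
Proof. rewrite /expect big_distrr; by apply: eq_bigr => A _; rewrite /= mulrA. Qed.

Lemma expect_sum (I : finType) (F : I -> {set T} -> R) :
  expect p (fun A => \sum_i F i A) = \sum_i expect p (F i).
Proof.
rewrite /expect exchange_big; apply: eq_bigr => A _; exact: big_distrl.
Qed.

(** A walk of length 2m contributes only if it meets at most m elements of T, so
    p may be replaced by y = p * th with th <= 1 at the price of a factor th^-m.
    The choice th = #|J| * 2m / D balances the two ways of extending a walk in
    [sum_supports_cons]. *)
Lemma expect_kernel_trace (m : nat) (D : R) :
  (0 < m)%N -> (0 < #|J|)%N -> (#|J| * m.*2)%:R <= D ->
  (forall v, #|[set x : T * J | tgt x.1 x.2 == v]|%:R * p <= D) ->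
  expect p (fun A => kernel_trace (kernel_pow (random_kernel A) m.*2)) <=
  (#|T| * #|J|)%:R * p * ((8 * #|J| * m)%:R * D) ^+ m.
Proof.
case/andP: (p01) => p0 p1 m0 J0 JD deg.
set K : R := (#|J| * m.*2)%:R.
have K1 : 1 <= K by rewrite ler1n muln_gt0 J0 double_gt0.
have K0 : 0 < K by apply: lt_le_trans K1.
have D0 : 0 < D by apply: lt_le_trans JD.
have [th thE] : exists th, th = K / D by exists (K / D).
have th0 : 0 < th by rewrite thE divr_gt0.
have th1 : th <= 1 by rewrite thE ler_pdivrMr // mul1r.
pose y := p * th.
have y0 : 0 <= y by rewrite mulr_ge0 // ltW.
have degy v : #|[set x : T * J | tgt x.1 x.2 == v]|%:R * y <= K.
  rewrite mulrA; apply: le_trans (ler_wpM2r (ltW th0) (deg v)) _.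
  by rewrite thE mulrCA divff ?mulr1 // gt_eqF.
pose con := consecutive src tgt.
have walks : expect p (fun A => kernel_trace (kernel_pow (random_kernel A) m.*2)) <=
   \sum_(s : (m.*2).-tuple (T * J)) (sorted con s)%:R *
      `|expect p (fun A => \prod_(t <- [seq x.1 | x <- s]) centred p A t)|.
  rewrite /kernel_trace expect_sum.
  under eq_bigr => v _.
    rewrite /random_kernel.
    have -> : expect p (fun A => kernel_pow (arc_kernel src tgt
        (fun x => c x.2 * centred p A x.1)) m.*2 v v) =
      \sum_(s : (m.*2).-tuple (T * J)) (walk src tgt v s v)%:R * (\prod_(x <- s) c x.2 *
         expect p (fun A => \prod_(t <- [seq x.1 | x <- s]) centred p A t)).
      under [RHS]eq_bigr do rewrite -!expectZ.
      rewrite -expect_sum; apply: eq_bigr => A _; rewrite kernel_pow_walks; congr (_ * _).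
      by apply: eq_bigr => s _; rewrite big_split /= big_map.
    over.
  rewrite exchange_big; apply: ler_sum => s _; rewrite -big_distrl /=.
  set e := expect _ _.
  have w0 : 0 <= \sum_i (walk src tgt i s i)%:R :> R by apply: sumr_ge0.
  apply: le_trans (ler_norm _) _; rewrite normrM (ger0_norm w0) normrM.
  apply: ler_pM; [exact: w0 | by apply: mulr_ge0 | |].
    by apply: sum_walk_le; rewrite size_tuple double_gt0.
  rewrite -[leRHS]mul1r; apply: ler_wpM2r => //; rewrite normr_prod.
  by apply: prodr_ile1 => x _; rewrite normr_ge0 c1.
apply: le_trans walks _.
have term (s : (m.*2).-tuple (T * J)) : (sorted con s)%:R *
      `|expect p (fun A => \prod_(t <- [seq x.1 | x <- s]) centred p A t)| <=
   th ^- m * ((sorted con s)%:R * y ^+ size (support s)).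
  rewrite [leRHS]mulrCA; apply: ler_wpM2l => //.
  apply: le_trans (expect_prod_centred p01 _) _; rewrite -/(support s).
  have nn : 0 <= th ^- m * y ^+ size (support s).
    by rewrite mulr_ge0 ?invr_ge0 ?exprn_ge0 // ltW.
  case: ifP => //; rewrite size_map size_tuple leq_double => sm.
  rewrite /y exprMn mulrCA -[leLHS]mulr1. apply: ler_wpM2l; first exact/exprn_ge0/ltW.
  by rewrite ler_pdivlMl ?exprn_gt0 // mulr1; apply: ler_wiXn2l => //; apply: ltW.
apply: le_trans (ler_sum _ (fun s _ => term s)) _.
rewrite -big_distrr /=.
have := @sum_supports R T J V src tgt y K m.*2 y0 degy m.*2.-1.
rewrite prednK ?double_gt0 // => /(_ (leqnn _)) bnd.
apply: le_trans (ler_wpM2l _ bnd) _; first by rewrite invr_ge0 exprn_ge0 // ltW.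
rewrite -/K /y -mulr2n -[K *+ 2]mulr_natl.
have -> : (8 * #|J| * m)%:R * D = (2 * K) ^+ 2 / th.
  rewrite thE invf_div /K -!mul2n !natrM.
  have : #|J|%:R != 0 :> R by rewrite pnatr_eq0 -lt0n.
  have : m%:R != 0 :> R by rewrite pnatr_eq0 -lt0n.
  by move=> ? ?; field; apply/andP.
have -> : th ^- m * ((#|T| * #|J|)%:R * (p * th) * (2 * K) ^+ m.*2.-1) =
   (#|T| * #|J|)%:R * p * th ^- m * (th * (2 * K) ^+ m.*2.-1).
  by move: (th ^- m) (_ ^+ _.-1) => a b; ring.
rewrite [((2 * K) ^+ 2 / th) ^+ m]exprMn exprVn -exprM mul2n [(_ ^+ _ / _)]mulrC [leRHS]mulrA.
apply: ler_wpM2l.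
  by rewrite !mulr_ge0 ?invr_ge0 ?exprn_ge0 // ltW.
rewrite -[in leRHS](prednK (_ : 0 < m.*2)%N) ?double_gt0 // exprS.
apply: ler_wpM2r; first by rewrite exprn_ge0 // mulr_ge0 // ltW.
lra.
Qed.

Lemma expect_markov (F : {set T} -> R) (e B : R) : 0 < e ->
  (forall A, 0 <= F A) -> expect p F <= B * e ->
  \sum_(A | F A < e) subset_weight p A >= 1 - B.
Proof.
move=> e0 F0 FB.
have := subset_weight_sum T p; rewrite (bigID (fun A => F A < e)) /=.
set a := \sum_(A | F A < e) _; set b := \sum_(A | _) _ => ab.
suff : b <= B by lra.
rewrite -(ler_pM2r e0); apply: le_trans FB.
rewrite /b big_distrl /= /expect [leRHS](bigID (fun A => F A < e)) /= addrC.
apply: (@le_trans _ _ (\sum_(A | ~~ (F A < e)) F A * subset_weight p A)).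
  apply: ler_sum => A; rewrite -leNgt => eF; rewrite mulrC.
  by apply: ler_wpM2r => //; apply: subset_weight_ge0.
by rewrite lerDl; apply: sumr_ge0 => A _; rewrite mulr_ge0 // subset_weight_ge0.
Qed.

End TraceMoment.

(** * The real inner product and the norm of a kernel *)

Section RealInner.
Local Open Scope complex_scope.
Variables (R : realType) (H : hilbertSpace R).

Definition rip (u v : H) : R := complex.Re (inner H u v).
Definition nsq (u : H) : R := rip u u.

Lemma ripC u v : rip u v = rip v u.
Proof.
rewrite /rip (hermC (inner H)) /= expr0 mul1r.
by case: (inner H v u).
Qed.

Lemma ripDl u v w : rip (u + v) w = rip u w + rip v w.
Proof. by rewrite /rip linearDl raddfD. Qed.

Lemma ripNl u w : rip (- u) w = - rip u w.
Proof. by rewrite /rip linearNl raddfN. Qed.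

Lemma rip0l w : rip 0 w = 0.
Proof. by rewrite /rip linear0l raddf0. Qed.

Lemma ripZl (a : R) u w : rip (a%:C *: u) w = a * rip u w.
Proof.
rewrite /rip linearZl_LR /=; case: (inner H u w) => x y /=.
by rewrite mul0r subr0.
Qed.

Lemma ripBl u v w : rip (u - v) w = rip u w - rip v w.
Proof. by rewrite ripDl ripNl. Qed.

Lemma rip_suml (I : Type) (r : seq I) (P : pred I) (F : I -> H) w :
  rip (\sum_(i <- r | P i) F i) w = \sum_(i <- r | P i) rip (F i) w.
Proof.
apply: (big_morph (rip^~ w)) => [u v|]; [exact: ripDl | exact: rip0l].
Qed.

Lemma ripDr u v w : rip w (u + v) = rip w u + rip w v.
Proof. by rewrite ripC ripDl !(ripC w). Qed.
Lemma ripNr u w : rip w (- u) = - rip w u.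
Proof. by rewrite ripC ripNl !(ripC w). Qed.
Lemma ripBr u v w : rip w (u - v) = rip w u - rip w v.
Proof. by rewrite ripDr ripNr. Qed.
Lemma ripZr (a : R) u w : rip w (a%:C *: u) = a * rip w u.
Proof. by rewrite ripC ripZl !(ripC w). Qed.
Lemma rip_sumr (I : Type) (r : seq I) (P : pred I) (F : I -> H) w :
  rip w (\sum_(i <- r | P i) F i) = \sum_(i <- r | P i) rip w (F i).
Proof. by rewrite ripC rip_suml; apply: eq_bigr => i _; rewrite ripC. Qed.

Lemma nsqE u : (nsq u)%:C = `|u| ^+ 2.
Proof.
rewrite -innerE /nsq /rip.
have : 0 <= inner H u u by rewrite innerE exprn_ge0.
by case: (inner H u u) => a b; rewrite lecE /= => /andP[/eqP -> _].
Qed.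

Lemma nsq_ge0 u : 0 <= nsq u.
Proof. by rewrite -(@lecR R) nsqE exprn_ge0. Qed.

Lemma nsq_eq0 u : (nsq u == 0) = (u == 0).
Proof.
have -> : (nsq u == 0) = ((nsq u)%:C == 0) by rewrite eq_complex /= eqxx andbT.
by rewrite nsqE expf_eq0 normr_eq0.
Qed.

Definition rnorm (u : H) : R := Num.sqrt (nsq u).

Lemma rnormE (u : H) : `|u| = (rnorm u)%:C.
Proof.
apply/eqP; rewrite -(eqrXn2 (n := 2)) ?normr_ge0 //; last by rewrite lecR sqrtr_ge0.
by rewrite -nsqE -rmorphXn /= sqr_sqrtr ?nsq_ge0.
Qed.

Lemma nsqD u v : nsq (u + v) = nsq u + nsq v + rip u v *+ 2.
Proof. rewrite /nsq !ripDl !ripDr (ripC v u) mulr2n; ring. Qed.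

Lemma nsqB u v : nsq (u - v) = nsq u + nsq v - rip u v *+ 2.
Proof. rewrite nsqD /nsq ripNl !ripNr opprK; ring. Qed.

Lemma nsqN u : nsq (- u) = nsq u.
Proof. by rewrite /nsq ripNl ripNr opprK. Qed.

Lemma nsqZ (a : R) u : nsq (a%:C *: u) = a ^+ 2 * nsq u.
Proof. by rewrite /nsq ripZl ripZr mulrA. Qed.

Lemma rip_le u v : rip u v *+ 2 <= nsq u + nsq v.
Proof. by rewrite -subr_ge0 -nsqB nsq_ge0. Qed.

Lemma nsqD_le u v : nsq (u + v) <= (nsq u + nsq v) *+ 2.
Proof. by rewrite nsqD; have := rip_le u v; lra. Qed.

(** Cauchy-Schwarz against the constant function 1, obtained by adding up
    2 <F i, F j> <= |F i|^2 + |F j|^2 over all pairs. *)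
Lemma nsq_sum_le (I : finType) (P : pred I) (F : I -> H) :
  nsq (\sum_(i | P i) F i) <= #|P|%:R * \sum_(i | P i) nsq (F i).
Proof.
rewrite /nsq rip_suml -(ler_pM2l (ltr0Sn R 1)).
apply: (@le_trans _ _ (\sum_(i | P i) \sum_(j | P j) (nsq (F i) + nsq (F j)))).
  rewrite big_distrr /=; apply: ler_sum => i _; rewrite rip_sumr big_distrr /=.
  by apply: ler_sum => j _; rewrite mulr_natl; exact: rip_le.
under eq_bigr do rewrite big_split /= sumr_const -mulr_natl.
rewrite big_split /= -big_distrr sumr_const -mulr_natl /=.
by rewrite [leRHS]mulr_natl mulr2n mulr1 -[X in _ + X <= _]mulr_natl.
Qed.

Section KernelForm.
Variables (V : finType) (N : V -> V -> R) (h : V -> H).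
Hypothesis Nsym : forall u v, N u v = N v u.

Definition kernel_form (K : V -> V -> R) : R := \sum_u \sum_v K u v * rip (h u) (h v).
Definition kernel_act (K : V -> V -> R) (u : V) : H := \sum_v (K u v)%:C *: h v.
Definition total_nsq : R := \sum_v nsq (h v).

Lemma total_nsq_ge0 : 0 <= total_nsq.
Proof. by apply: sumr_ge0 => v _; apply: nsq_ge0. Qed.

Lemma kernel_formE K : kernel_form K = \sum_u rip (h u) (kernel_act K u).
Proof.
apply: eq_bigr => u _; rewrite rip_sumr; apply: eq_bigr => v _.
by rewrite ripZr.
Qed.

Lemma kernel_form_double n :
  kernel_form (kernel_pow N (n + n)) = \sum_u nsq (kernel_act (kernel_pow N n) u).
Proof.
rewrite /kernel_form /nsq.
transitivity (\sum_u \sum_v \sum_w (kernel_pow N n w u * kernel_pow N n w v) * rip (h u) (h v)).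
  apply: eq_bigr => u _; apply: eq_bigr => v _; rewrite kernel_powD big_distrl /=.
  by apply: eq_bigr => w _; rewrite (kernel_pow_sym _ Nsym u w).
under eq_bigr do rewrite exchange_big /=.
rewrite exchange_big /=; apply: eq_bigr => w _.
rewrite /kernel_act rip_suml; apply: eq_bigr => u _.
rewrite rip_sumr; apply: eq_bigr => v _.
by rewrite ripZl ripZr mulrA.
Qed.

(** Cauchy-Schwarz for the vectors h and N^n h, since the form of N^(2n) at h is
    the squared norm of N^n h. *)
Lemma kernel_form_sqr n : kernel_form (kernel_pow N n) ^+ 2 <=
  kernel_form (kernel_pow N (n + n)) * total_nsq.
Proof.
rewrite kernel_form_double kernel_formE.
set S := \sum_u rip _ _; set Q := \sum_u _; set G := total_nsq.
have key (t : R) : 2 * t * S <= Q + t ^+ 2 * G.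
  rewrite /S /Q /G /total_nsq !big_distrr /= -big_split /=; apply: ler_sum => u _.
  by have := rip_le (t%:C *: h u) (kernel_act (kernel_pow N n) u); rewrite nsqZ ripZl; lra.
have G0 : 0 <= G by apply: total_nsq_ge0.
have [G00|Gn] := eqVneq G 0.
  have Q0 : 0 <= Q by apply: sumr_ge0 => u _; apply: nsq_ge0.
  have S0 : S = 0.
    have k1 := key (Q + 1); have k2 := key (- (Q + 1)).
    rewrite G00 in k1 k2.
    have h1 : S < 1 by nra.
    have h2 : -1 < S by nra.
    have k3 := key ((Q + 1) / S).
    apply/eqP; apply: contraT => Sn; move: k3; rewrite G00 -mulrA divfK // mulr0; lra.
  by rewrite S0 expr0n mulr_ge0.
have Gp : 0 < G by rewrite lt_def Gn.
(* This t minimises Q + t^2 G - 2 t S. *)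
have := key (S / G).
rewrite -(ler_pM2r Gp).
have -> : 2 * (S / G) * S * G = 2 * S ^+ 2 by field.
have -> : (Q + (S / G) ^+ 2 * G) * G = Q * G + S ^+ 2 by field.
lra.
Qed.

(** For even powers the trace is the squared Hilbert-Schmidt norm of N^n. *)
Lemma kernel_form_trace n :
  kernel_form (kernel_pow N (n + n)) <= kernel_trace (kernel_pow N (n + n)) * total_nsq.
Proof.
rewrite kernel_form_double /kernel_trace big_distrl /=; apply: ler_sum => u _.
rewrite kernel_powD big_distrl /= /nsq /kernel_act.
rewrite -(ler_pM2l (ltr0Sn R 1)).
rewrite rip_suml big_distrr /=.
apply: (@le_trans _ _ (\sum_v \sum_w kernel_pow N n u v ^+ 2 * nsq (h w)
    + \sum_v \sum_w kernel_pow N n u w ^+ 2 * nsq (h v))).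
  rewrite -big_split /=; apply: ler_sum => v _; rewrite -big_split rip_sumr big_distrr /=.
  apply: ler_sum => w _.
  rewrite ripZl ripZr.
  have := rip_le ((kernel_pow N n u w)%:C *: h v) ((kernel_pow N n u v)%:C *: h w).
  by rewrite ripZl ripZr !nsqZ; lra.
have e : \sum_v \sum_w kernel_pow N n u v ^+ 2 * nsq (h w) =
         \sum_v kernel_pow N n u v * kernel_pow N n v u * total_nsq.
  apply: eq_bigr => v _; rewrite -big_distrr /= -/total_nsq; congr (_ * _).
  by rewrite (kernel_pow_sym n Nsym v u).
rewrite [X in _ + X]exchange_big /= e.
by rewrite [leRHS]mulr_natl mulr2n.
Qed.

(** Squaring repeatedly with [kernel_form_sqr] carries the bound from the
    exponent 2^(j+1), where it is the trace, down to 1. *)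
Lemma kernel_form_le (theta : R) j : 0 < theta ->
  kernel_trace (kernel_pow N (2 ^ j.+1)) <= theta ^+ (2 ^ j.+1) ->
  kernel_form N <= theta * total_nsq.
Proof.
move=> th0 tr; have G0 := total_nsq_ge0.
pose b n := kernel_form (kernel_pow N n).
have b1 : b 1%N = kernel_form N.
  by apply: eq_bigr => u _; apply: eq_bigr => v _; rewrite kernel_pow1.
have bnd i : (i <= j)%N -> b (2 ^ (j.+1 - i))%N <= theta ^+ (2 ^ (j.+1 - i)) * total_nsq.
  elim: i => [|i IH] ij.
    rewrite subn0 expnS mul2n -addnn; apply: le_trans (kernel_form_trace _) _.
    by rewrite addnn -mul2n -expnS; apply: ler_wpM2r.
  have /IH : (i <= j)%N by apply: ltnW.
  have -> : (j.+1 - i = (j.+1 - i.+1).+1)%N by rewrite subnSK // ltnW.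
  set m := (j.+1 - i.+1)%N; rewrite expnS mul2n -addnn => bm.
  have := kernel_form_sqr (2 ^ m); rewrite -/(b _) -/(b _) => sq.
  have := le_trans sq (ler_wpM2r G0 bm).
  rewrite exprD -!mulrA (mulrCA _ total_nsq) mulrA => h2.
  apply: (@le_trans _ _ `|b (2 ^ m)%N|); first exact: ler_norm.
  rewrite -(@ler_pXn2r _ 2) ?nnegrE ?mulr_ge0 ?exprn_ge0 ?(ltW th0) //.
  by rewrite -normrX ger0_norm ?sqr_ge0 //; apply: le_trans h2 _; rewrite [leRHS]expr2 !mulrA lexx.
have := bnd j (leqnn _); rewrite subSnn expn1 => b2.
have := kernel_form_sqr 1; rewrite -/(b _) -/(b _) => sq.
rewrite -b1; apply: (@le_trans _ _ `|b 1%N|); first exact: ler_norm.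
rewrite -(@ler_pXn2r _ 2) ?nnegrE ?mulr_ge0 ?(ltW th0) //.
rewrite -normrX ger0_norm ?sqr_ge0 //; apply: le_trans sq _.
by rewrite exprMn [total_nsq ^+ 2]expr2 mulrA; apply: ler_wpM2r.
Qed.

End KernelForm.

End RealInner.

(** * Descent to a harmonic vector *)

Section Descent.
Local Open Scope classical_set_scope.
Local Open Scope ring_scope.
Local Open Scope complex_scope.
Variables (R : realType) (H : hilbertSpace R).

Lemma rnorm_ge0 (u : H) : 0 <= rnorm u.
Proof. exact: sqrtr_ge0. Qed.

Lemma rnorm_sqr (u : H) : rnorm u ^+ 2 = nsq u.
Proof. by rewrite sqr_sqrtr ?nsq_ge0. Qed.

Lemma rnormD (u v : H) : rnorm (u + v) <= rnorm u + rnorm v.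
Proof. by rewrite -(@lecR R) rmorphD /= -!rnormE ler_normD. Qed.

Lemma rnormN (u : H) : rnorm (- u) = rnorm u.
Proof. by rewrite /rnorm nsqN. Qed.

Lemma rnormBC (u v : H) : rnorm (u - v) = rnorm (v - u).
Proof. by rewrite -opprB rnormN. Qed.

Lemma rnorm_le (u : H) (a : R) : 0 <= a -> nsq u <= a ^+ 2 -> rnorm u <= a.
Proof. by move=> a0 ua; rewrite -(@ler_pXn2r _ 2) ?nnegrE ?rnorm_ge0 // rnorm_sqr. Qed.

Lemma geometric_small (K s e : R) : 0 <= s < 1 -> 0 < e -> exists n, K * s ^+ n < e.
Proof.
move=> /andP[s0 s1] e0; have : (fun n => K * s ^+ n) @ \oo --> K * 0.
  by apply: cvgM; [exact: cvg_cst | apply: cvg_expr; rewrite ger0_norm].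
rewrite mulr0 => /cvgrPdist_lt /(_ e e0) [n _ /(_ n (leqnn n))] /=.
rewrite sub0r normrN => h; exists n; exact: le_lt_trans (ler_norm _) h.
Qed.

(** Completeness, with the explicit rate that makes the limit of the descent
    close to its starting point. *)
Lemma geometric_cvg (u : nat -> H) (c s : R) : 0 <= c -> 0 <= s < 1 ->
  (forall n, rnorm (u n.+1 - u n) <= c * s ^+ n) ->
  exists w, forall n, rnorm (w - u n) <= c / (1 - s) * s ^+ n.
Proof.
move=> c0 /andP[s0 s1] step.
have s1' : 0 < 1 - s by lra.
set K := c / (1 - s); have K0 : 0 <= K by rewrite divr_ge0 // ltW.
have dist m n : rnorm (u (n + m)%N - u n) <= K * s ^+ n * (1 - s ^+ m).
  elim: m => [|m IH].
    by rewrite addn0 subrr expr0 subrr mulr0 /rnorm /nsq rip0l sqrtr0.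
  rewrite addnS -(subrKA (u (n + m)%N)); apply: le_trans (rnormD _ _) _.
  apply: le_trans (lerD (step _) IH) _.
  have -> : c = K * (1 - s) by rewrite divfK // gt_eqF.
  by rewrite exprD exprS; lra.
have distle m n : (n <= m)%N -> rnorm (u m - u n) <= K * s ^+ n.
  move=> nm; rewrite -(subnKC nm); apply: le_trans (dist _ _) _.
  rewrite -[leRHS]mulr1; apply: ler_wpM2l; first by rewrite mulr_ge0 ?exprn_ge0.
  by rewrite gerBl exprn_ge0.
have : cvg (u @ \oo).
  apply: cauchy_cvg; apply: cauchy_exP => e.
  case: e => a b; rewrite ltcE /= => /andP[/eqP -> a0].
  have [n hn] := @geometric_small K s a (introT andP (conj s0 s1)) a0.
  exists (u n); exists n => // m /= nm.
  rewrite -ball_normE /= rnormE ltcR rnormBC.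
  exact: le_lt_trans (distle _ _ nm) hn.
move=> /cvg_ex [w uw]; exists w => n.
apply/ler_addgt0Pr => e e0.
have ec : 0 < e%:C by rewrite ltcR.
move/cvgrPdist_lt: uw => /(_ _ ec) [m _ hm].
have := hm (maxn m n) (leq_maxl _ _); rewrite rnormE ltcR => hw.
rewrite -(subrKA (u (maxn m n))); apply: le_trans (rnormD _ _) _.
by rewrite addrC; apply: lerD; [apply: distle; rewrite leq_maxr | apply: ltW].
Qed.

Variable Delta : H -> H.
Hypothesis DeltaB : forall u v, Delta (u - v) = Delta u - Delta v.
Hypothesis DeltaZ : forall (a : R) u, Delta (a%:C *: u) = a%:C *: Delta u.
Hypothesis Delta_sym : forall u v, rip (Delta u) v = rip u (Delta v).

Definition energy (u : H) : R := rip (Delta u) u.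

(** The constants below are those of a sum of three operators 1 - P, where P is a
    self-adjoint contraction. *)
Hypothesis energy_ge0 : forall u, 0 <= energy u.
Hypothesis energy_le : forall u, energy u <= 6 * nsq u.
Hypothesis Delta_le : forall u, nsq (Delta u) <= 6 * energy u.
Hypothesis spectral_gap : forall u, energy u <= 2 * nsq (Delta u).

Lemma energyB u v : energy (u - v) = energy u + energy v - 2 * rip (Delta u) v.
Proof.
by rewrite /energy DeltaB ripBl !ripBr (Delta_sym v u) (ripC v); ring.
Qed.

(** One step lowers the energy by at least |Delta u|^2 / 6, which the spectral
    gap compares with the energy itself. *)
Lemma energy_step u : energy (u - (6^-1)%:C *: Delta u) <= 11 / 12 * energy u.
Proof.
rewrite energyB {2}/energy DeltaZ ripZl !ripZr -/(nsq (Delta u)) -/(energy (Delta u)).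
have := energy_le (Delta u); have := spectral_gap u; lra.
Qed.

(** Both the energies and the steps decay geometrically, so the descent converges
    at a distance from v controlled by the energy of v; the limit has energy 0
    because the energy is a bounded quadratic form. *)
Lemma gradient_descent v :
  exists2 w, energy w = 0 & rnorm (w - v) <= 13 * Num.sqrt (energy v).
Proof.
pose step u := u - (6^-1)%:C *: Delta u.
pose u n := iter n step v.
(* The square of s exceeds the factor 11/12 by which a step contracts the energy. *)
have [s sE] : exists s : R, s = 24 / 25 by eexists.
have s0 : 0 <= s by rewrite sE; lra.
have en n : energy (u n) <= energy v * (s ^+ n) ^+ 2.
  elim: n => [|n IH]; first by rewrite expr0 expr1n mulr1.
  apply: le_trans (energy_step _) _; rewrite (exprS s n) exprMn.
  have h : 11 / 12 <= s ^+ 2 by rewrite sE; lra.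
  apply: (@le_trans _ _ (s ^+ 2 * (energy v * (s ^+ n) ^+ 2))); last by rewrite mulrCA.
  by apply: ler_pM => //; lra.
have st n : rnorm (u n.+1 - u n) <= 1 / 2 * Num.sqrt (energy v) * s ^+ n.
  rewrite /u iterS /step addrC addKr rnormN; apply: rnorm_le.
    by rewrite !mulr_ge0 ?sqrtr_ge0 ?exprn_ge0 //; lra.
  rewrite nsqZ -/(u n) !exprMn sqr_sqrtr //.
  by have := Delta_le (u n); have := en n; have := energy_ge0 (u n); lra.
have [||w hw] := geometric_cvg _ _ st.
- by rewrite mulr_ge0 ?sqrtr_ge0 //; lra.
- by apply/andP; split=> //; rewrite sE; lra.
exists w; last first.
  have := hw 0%N; rewrite /u /= expr0 mulr1 => /le_trans; apply.
  have -> : (1 - s)^-1 = 25 by rewrite sE; field.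
  by have := sqrtr_ge0 (energy v); lra.
apply/eqP; rewrite eq_le energy_ge0 andbT leNgt; apply/negP => Ew0.
set K := 1 / 2 * Num.sqrt (energy v) / (1 - s) in hw.
have s01 : 0 <= s < 1 by apply/andP; split=> //; rewrite sE; lra.
have [n] := geometric_small (7 * energy v + 7 * K ^+ 2) s01 Ew0.
apply/negP; rewrite -leNgt.
set d := u n - w.
have dK : nsq d <= K ^+ 2 * (s ^+ n) ^+ 2.
  rewrite -exprMn -rnorm_sqr ler_pXn2r ?nnegrE ?rnorm_ge0 //.
    by rewrite rnormBC.
  exact: le_trans (rnorm_ge0 _) (hw n).
have -> : w = u n - d by rewrite subKr.
rewrite energyB.
have := rip_le (- Delta (u n)) d; rewrite ripNl nsqN.
have := Delta_le (u n); have := energy_le d; have := en n.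
have sn1 : (s ^+ n) ^+ 2 <= s ^+ n.
  by rewrite expr2 ger_pMl ?exprn_gt0 ?exprn_ile1 //; rewrite sE; lra.
have := ler_wpM2l (sqr_ge0 K) sn1; have := ler_wpM2l (energy_ge0 v) sn1.
lra.
Qed.

End Descent.

(** * Counting cyclically reduced words *)

Section Words.
Variables (R : realFieldType) (k : nat).
Hypothesis k2 : (2 <= k)%N.
Local Notation L := (letter k).

Definition compat (x y : L) : bool := y != inv_letter x.
Definition reduced (w : seq L) : bool := sorted compat w.
(** The number of letters that may follow a given letter. *)
Definition growth : R := 2 * k%:R - 1.
Local Notation q := growth.

Lemma card_letter : #|L|%:R = q + 1 :> R.
Proof. by rewrite card_prod card_ord card_bool natrM /q; ring. Qed.

Lemma growth_ge3 : 3 <= q.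
Proof. by have : 2%:R <= k%:R :> R; [rewrite ler_nat | rewrite /growth => ?; lra]. Qed.

Lemma sum_compat (x : L) (F : L -> R) :
  \sum_y (compat x y)%:R * F y = \sum_y F y - F (inv_letter x).
Proof.
rewrite [in RHS](bigD1 (inv_letter x)) //= addrAC subrr add0r.
rewrite (bigD1 (inv_letter x)) //= {1}/compat eqxx mul0r add0r.
by apply: eq_bigr => y yx; rewrite /compat yx mul1r.
Qed.

Lemma sum_inv_letter (F : L -> R) : \sum_x F (inv_letter x) = \sum_x F x.
Proof.
by rewrite [RHS](reindex_inj (inv_inj (@inv_letterK k))).
Qed.

Definition path_count a (s t : L) : R :=
  \sum_(x : a.-tuple L) (path compat s (rcons x t))%:R.

Lemma path_count0 s t : path_count 0 s t = (compat s t)%:R.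
Proof.
by rewrite /path_count (sum_tuple0 (fun x => (path compat s (rcons x t))%:R)) /= andbT.
Qed.

Lemma path_countS a s t :
  path_count a.+1 s t = \sum_x path_count a x t - path_count a (inv_letter s) t.
Proof.
rewrite /path_count (sum_tuple_cons a (fun x => (path compat s (rcons x t))%:R)) /=.
rewrite -(sum_compat s (fun x => path_count a x t)); apply: eq_bigr => x _.
rewrite big_distrr /=; apply: eq_bigr => w _.
by rewrite -natrM mulnb.
Qed.

Lemma sum_path_count a t : \sum_s path_count a s t = q ^+ a.+1.
Proof.
elim: a => [|a IH].
  under eq_bigr do rewrite path_count0.
  rewrite (eq_bigr (fun s => (compat t s)%:R * 1)) => [|s _]; last first.
    rewrite mulr1 /compat; congr (~~ _)%:R.
    by apply/eqP/eqP => ->; rewrite inv_letterK.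
  by rewrite sum_compat sumr_const card_letter expr1; lra.
under eq_bigr do rewrite path_countS.
rewrite sumrB (sum_inv_letter (fun s => path_count a s t)) sumr_const IH.
rewrite -mulr_natl card_letter [in RHS]exprS; ring.
Qed.

(** By [path_countS], a recursion that subtracts the count for the forbidden letter
    from a sum not depending on s, a difference for words of length a + 1 is again
    one for words of length a. *)
Lemma path_count_diff a s s' t : path_count a s t - path_count a s' t <= 1.
Proof.
elim: a s s' => [|a IH] s s'; last first.
  by rewrite !path_countS; have := IH (inv_letter s') (inv_letter s); lra.
by rewrite !path_count0; case: (compat s t); case: (compat s' t) => /=; lra.
Qed.

(** The counts differ by at most 1 when s varies, so each is within 1 of their
    average, which is known exactly. *)
Lemma path_count_bounds a s t :
  q ^+ a.+1 / (q + 1) - 1 <= path_count a s t <= q ^+ a.+1 / (q + 1) + 1.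
Proof.
have q3 := growth_ge3; have n0 : 0 < q + 1 by lra.
have av : (q + 1) * path_count a s t - q ^+ a.+1 = \sum_s' (path_count a s t - path_count a s' t).
  by rewrite sumrB sum_path_count sumr_const -mulr_natl card_letter.
have le1 : (q + 1) * path_count a s t - q ^+ a.+1 <= q + 1.
  rewrite av -card_letter -sumr_const; apply: ler_sum => s' _; exact: path_count_diff.
have ge1 : q ^+ a.+1 - (q + 1) * path_count a s t <= q + 1.
  rewrite -opprB av -sumrN -card_letter -sumr_const; apply: ler_sum => s' _.
  by rewrite opprB path_count_diff.
apply/andP; split.
  by rewrite lerBlDr ler_pdivrMr //; lra.
by rewrite -lerBlDr ler_pdivlMr //; lra.
Qed.

Lemma card_reduced_from m (s : L) : \sum_(x : m.-tuple L) (path compat s x)%:R = q ^+ m.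
Proof.
elim: m s => [|m IH] s; first by rewrite (sum_tuple0 (fun x => (path compat s x)%:R)).
rewrite (sum_tuple_cons m (fun x => (path compat s x)%:R)) /=.
transitivity (\sum_x (compat s x)%:R * q ^+ m).
  apply: eq_bigr => x _; rewrite -(IH x) big_distrr /=; apply: eq_bigr => w _.
  by rewrite -natrM mulnb.
rewrite (sum_compat s (fun=> q ^+ m)) sumr_const -mulr_natl card_letter exprS; ring.
Qed.

(** Read cyclically, a word x completing s :: u is inserted between the last and
    the first letter of s :: u. *)
Lemma cyclic_filling a s (u : seq L) :
  \sum_(x : a.-tuple L) (cyclically_reduced (x ++ s :: u))%:R =
  (path compat s u)%:R * path_count a (last s u) s.
Proof.
rewrite /path_count big_distrr /=; apply: eq_bigr => x _.
rewrite /cyclically_reduced -(rot_cycle (size x)) rot_size_cat.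
by rewrite -natrM mulnb /= rcons_cat cat_path.
Qed.

Lemma cyclically_reduced_catC (x y : seq L) :
  cyclically_reduced (x ++ y) = cyclically_reduced (y ++ x).
Proof. by rewrite /cyclically_reduced -(rot_cycle (size x)) rot_size_cat. Qed.

Section Triples.
Variables a b c : nat.

(** The sum over all relators, cut into three words of the given lengths; see
    [relator_sum].  This form is invariant under cyclic rotation
    ([triple_sum_rot]), so each statement is needed for one of the parts only. *)
Definition triple_sum (F : seq L -> seq L -> seq L -> R) : R :=
  \sum_(x : a.-tuple L) \sum_(y : b.-tuple L) \sum_(z : c.-tuple L)
    (cyclically_reduced (x ++ y ++ z))%:R * F x y z.

Lemma triple_sum_first_le (F : seq L -> R) : (0 < a)%N -> (forall x, 0 <= F x) ->
  triple_sum (fun x _ _ => F x) <=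
  (q ^+ (b + c).+1 / (q + 1) + 1) * \sum_(x : a.-tuple L | reduced x) F x.
Proof.
move=> a0 F0; rewrite big_distrr [leRHS]big_mkcond /=; apply: ler_sum => x _.
under eq_bigr do rewrite -big_distrl /=.
rewrite -big_distrl /=.
have := sum_tuple_cat b c (fun w => (cyclically_reduced (x ++ w))%:R : R).
move=> <-; under eq_bigr do rewrite cyclically_reduced_catC.
case: x => [[|s u] sz] /=; first by rewrite -(eqP sz) in a0.
rewrite cyclic_filling.
case: ifP => _; rewrite ?mul0r ?mul1r //.
by apply: ler_wpM2r => //; case/andP: (path_count_bounds (b + c) (last s u) s).
Qed.

Lemma triple_sum_last_ge (F : seq L -> seq L -> R) : (0 < b)%N -> (forall y z, 0 <= F y z) ->
  (q ^+ a.+1 / (q + 1) - 1) *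
    \sum_(y : b.-tuple L) \sum_(z : c.-tuple L) (reduced (y ++ z))%:R * F y z <=
  triple_sum (fun _ y z => F y z).
Proof.
move=> b0 F0; rewrite /triple_sum [leRHS]exchange_big /= big_distrr /=; apply: ler_sum => y _.
rewrite [leRHS]exchange_big /= big_distrr /=; apply: ler_sum => z _.
rewrite -big_distrl /= mulrA; apply: ler_wpM2r => //.
case: y => [[|s u] sz] /=; first by rewrite -(eqP sz) in b0.
rewrite cyclic_filling mulrC.
apply: ler_wpM2l => //.
by case/andP: (path_count_bounds a (last s (u ++ z)) s).
Qed.

End Triples.

Lemma triple_sum_rot a b c F :
  triple_sum a b c F = triple_sum b c a (fun y z x => F x y z).
Proof.
rewrite /triple_sum exchange_big; apply: eq_bigr => y _; rewrite exchange_big.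
apply: eq_bigr => z _; apply: eq_bigr => x _.
by rewrite cyclically_reduced_catC -catA.
Qed.

Lemma relator_sum a b c (F : seq L -> seq L -> seq L -> R) :
  \sum_(t : relator k (a + (b + c)))
    F (take a (val (val t))) (take b (drop a (val (val t)))) (drop b (drop a (val (val t)))) =
  triple_sum a b c F.
Proof.
pose G w := (cyclically_reduced w)%:R * F (take a w) (take b (drop a w)) (drop b (drop a w)).
transitivity (\sum_(w : (a + (b + c)).-tuple L) G w).
  rewrite (bigID (fun w : (a + (b + c)).-tuple L => cyclically_reduced w)) /=.
  rewrite [X in _ = _ + X]big1 ?addr0; last by move=> w /negbTE wn; rewrite /G wn mul0r.
  rewrite (reindex_omap (val : relator k (a + (b + c)) -> _) insub) /=; last first.
    by move=> w wc; rewrite insubT.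
  apply: eq_big => [t|t _]; last by rewrite /G (valP t) mul1r.
  by rewrite valK eqxx (valP t).
rewrite (sum_tuple_cat a (b + c) G); apply: eq_bigr => x _.
rewrite (sum_tuple_cat b c (fun w => G (x ++ w))); apply: eq_bigr => y _.
apply: eq_bigr => z _; rewrite /G.
by rewrite take_size_cat ?size_tuple // drop_size_cat ?size_tuple // take_size_cat
  ?size_tuple // drop_size_cat ?size_tuple.
Qed.

End Words.

(** * The Poincare inequality of the mean link *)

Section InverseWords.
Variable k : nat.
Local Notation L := (letter k).
Local Notation compat := (@compat k).

Lemma size_inv_word (w : seq L) : size (inv_word w) = size w.
Proof. by rewrite size_rev size_map. Qed.

Definition inv_tuple n (w : n.-tuple L) : n.-tuple L :=
  Tuple (introT eqP (etrans (size_inv_word w) (size_tuple w))).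

Lemma inv_tupleK n : involutive (@inv_tuple n).
Proof. by move=> w; apply: val_inj; apply: inv_wordK. Qed.

Lemma sum_inv_word (V : nmodType) n (F : seq L -> V) :
  \sum_(w : n.-tuple L) F (inv_word w) = \sum_(w : n.-tuple L) F w.
Proof. by rewrite [RHS](reindex_inj (inv_inj (@inv_tupleK n))). Qed.

Lemma compat_sym (x y : L) : compat x y = compat y x.
Proof. by rewrite /compat; congr (~~ _); apply/eqP/eqP => ->; rewrite inv_letterK. Qed.

Lemma reduced_inv (w : seq L) : reduced (inv_word w) = reduced w.
Proof.
rewrite /reduced /inv_word rev_sorted sorted_map; apply: eq_sorted => x y.
by rewrite compat_sym /compat /= (inj_eq (inv_inj (@inv_letterK k))).
Qed.

Lemma reduced_inv_cat (s t : L) (u z : seq L) :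
  reduced (inv_word (s :: u) ++ t :: z) = [&& path compat s u, t != s & path compat t z].
Proof.
have -> : path compat s u = reduced (inv_word (s :: u)) by rewrite reduced_inv.
rewrite /reduced /inv_word /= rev_cons.
have -> : (t != s) = compat (inv_letter s) t by rewrite /compat inv_letterK.
case: (rev _) => [|x w] //=.
by rewrite cat_path /= last_rcons.
Qed.

Lemma sum_reduced_cons (V : nmodType) m (F : seq L -> V) :
  \sum_(w : m.+1.-tuple L | reduced w) F w =
  \sum_s \sum_(x : m.-tuple L | path compat s x) F (s :: x).
Proof.
rewrite big_mkcond (sum_tuple_cons m (fun w => if reduced w then F w else 0)).
by apply: eq_bigr => s _; rewrite [RHS]big_mkcond.
Qed.

End InverseWords.

Section LinkForm.
Local Open Scope complex_scope.
Variables (R : realType) (k : nat).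
Hypothesis k2 : (2 <= k)%N.
Variable H : hilbertSpace R.
Local Notation L := (letter k).
Local Notation compat := (@compat k).
Local Notation q := (growth R k).

Lemma growth_gt0 : 0 < q.
Proof. by have := growth_ge3 R k2; lra. Qed.

Lemma card_path m (s : L) : #|[pred x : m.-tuple L | path compat s x]|%:R = q ^+ m.
Proof.
rewrite -(card_reduced_from R m s) -sum1_card natr_sum big_mkcond /=.
by apply: eq_bigr => x _; rewrite inE; case: ifP.
Qed.

Definition cross (phi psi : L -> H) : R :=
  rip (\sum_s phi s) (\sum_s psi s) - \sum_s rip (phi s) (psi s).

Section Normalised.
Variable f : seq L -> H.

(** Up to the common factor 1 / #|L|, the contribution to the average over the
    sphere of the words that begin with s. *)
Definition mean_from m (s : L) : H :=
  (q ^- m)%:C *: \sum_(x : m.-tuple L | path compat s x) f (s :: x).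

Definition mean_nsq_from m (s : L) : R :=
  q ^- m * \sum_(x : m.-tuple L | path compat s x) nsq (f (s :: x)).

Lemma mean_from_le m s : nsq (mean_from m s) <= mean_nsq_from m s.
Proof.
have growth_gt0' := growth_gt0; rewrite nsqZ /mean_nsq_from expr2 -mulrA.
apply: ler_wpM2l; first by rewrite invr_ge0 exprn_ge0 // ltW.
apply: le_trans (ler_wpM2l _ (nsq_sum_le _ _)) _.
  by rewrite invr_ge0 exprn_ge0 // ltW.
by rewrite (card_path m s) mulKf // expf_neq0 // gt_eqF.
Qed.

(** All pairs of reduced words with given distinct first letters are joined: each
    pair of letters contributes a complete bipartite graph. *)
Lemma block_sum m n s t :
  \sum_(u : m.-tuple L | path compat s u) \sum_(z : n.-tuple L | path compat t z)
     nsq (f (t :: z) - f (s :: u)) =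
  q ^+ m * q ^+ n * (mean_nsq_from m s + mean_nsq_from n t
                     - rip (mean_from m s) (mean_from n t) *+ 2).
Proof.
have qm j : q ^+ j != 0 by rewrite expf_neq0 // gt_eqF // growth_gt0.
rewrite /mean_from /mean_nsq_from ripZl ripZr.
set Nm := \sum_(x : m.-tuple L | path compat s x) nsq (f (s :: x)).
set Nn := \sum_(x : n.-tuple L | path compat t x) nsq (f (t :: x)).
set r := rip _ _.
transitivity (q ^+ m * Nn + q ^+ n * Nm - r *+ 2); last first.
  by have := qm m; have := qm n; move: (q ^+ m) (q ^+ n) => x y ? ?; field; apply/andP.
transitivity (\sum_(u : m.-tuple L | path compat s u)
   (Nn + q ^+ n * nsq (f (s :: u))
     - rip (f (s :: u)) (\sum_(z : n.-tuple L | path compat t z) f (t :: z)) *+ 2)).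
  apply: eq_bigr => u _.
  rewrite (eq_bigr (fun z : n.-tuple L => nsq (f (t :: z)) +
     (nsq (f (s :: u)) - rip (f (s :: u)) (f (t :: z)) *+ 2))) => [|z _]; last first.
    by rewrite nsqB ripC; lra.
  rewrite big_split /= -/Nn sumrB sumr_const sumrMnl -rip_sumr -mulr_natl (card_path n t).
  by rewrite addrA.
rewrite sumrB big_split /= sumr_const -[Nn *+ _]mulr_natl (card_path m s) -big_distrr /=.
by rewrite sumrMnl -rip_suml.
Qed.

Definition pair_sum b c : R :=
  \sum_(y : b.-tuple L) \sum_(z : c.-tuple L)
    (reduced (y ++ z))%:R * nsq (f z - f (inv_word y)).

Lemma pair_sumE b c : pair_sum b.+1 c.+1 = q ^+ b * q ^+ c *
  (q * (\sum_s mean_nsq_from b s + \sum_s mean_nsq_from c s)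
   - cross (mean_from b) (mean_from c) *+ 2).
Proof.
rewrite /cross /pair_sum -(@sum_inv_word k _ b.+1 (fun y => \sum_(z : c.+1.-tuple L)
    (reduced (y ++ z))%:R * nsq (f z - f (inv_word y)))).
under eq_bigr do rewrite inv_wordK.
rewrite (sum_tuple_cons b (fun y => \sum_(z : c.+1.-tuple L)
    (reduced (inv_word y ++ z))%:R * nsq (f z - f y))).
pose B s t := mean_nsq_from b s + mean_nsq_from c t
                     - rip (mean_from b s) (mean_from c t) *+ 2.
transitivity (\sum_s \sum_t (t != s)%:R * (q ^+ b * q ^+ c * B s t)).
  apply: eq_bigr => s _.
  transitivity (\sum_t \sum_(u : b.-tuple L) \sum_(z : c.-tuple L)
     (reduced (inv_word (s :: u) ++ t :: z))%:R * nsq (f (t :: z) - f (s :: u))).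
    rewrite [RHS]exchange_big; apply: eq_bigr => u _.
    by rewrite (sum_tuple_cons c (fun z => (reduced (inv_word (s :: u) ++ z))%:R
        * nsq (f z - f (s :: u)))).
  apply: eq_bigr => t _; rewrite /B -block_sum big_distrr [RHS]big_mkcond /=.
  apply: eq_bigr => u _; case: ifP => su; last first.
    by apply: big1 => z _; rewrite reduced_inv_cat su mul0r.
  rewrite big_distrr [RHS]big_mkcond; apply: eq_bigr => z _ /=.
  rewrite reduced_inv_cat su /=.
  by case: (path compat t z); rewrite ?andbT // andbF mul0r.
transitivity (q ^+ b * q ^+ c * (\sum_s (\sum_t B s t - B s s))).
  rewrite big_distrr; apply: eq_bigr => s _ /=.
  rewrite (bigD1 s) //= eqxx mul0r add0r [in RHS](bigD1 s) //= addrAC subrr add0r.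
  by rewrite big_distrr; apply: eq_bigr => t /= ->; rewrite mul1r.
congr (_ * _); rewrite sumrB /B.
under eq_bigr do rewrite sumrB big_split /= sumr_const sumrMnl -rip_sumr.
rewrite !sumrB !big_split /= !sumrMnl -rip_suml sumr_const.
rewrite -[(\sum_s mean_nsq_from c s) *+ _]mulr_natl -[(\sum_s mean_nsq_from b s) *+ _]mulr_natl.
rewrite (card_letter R k); ring.
Qed.

End Normalised.

(** The cross terms of the sums over all letters add up to at most the squared
    norm of the total.  The diagonal terms, which are missing because words with
    the same first letter are not joined, can be negative by at most the nu, by
    positivity of |phi1 s + phi2 s + phi3 s|^2. *)
Lemma tripartite_form (phi1 phi2 phi3 : L -> H) (nu1 nu2 nu3 : L -> R) :
  (forall s, nsq (phi1 s) <= nu1 s) -> (forall s, nsq (phi2 s) <= nu2 s) ->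
  (forall s, nsq (phi3 s) <= nu3 s) ->
  (cross phi1 phi2 + cross phi2 phi3 + cross phi3 phi1) *+ 2 <=
  nsq (\sum_s phi1 s + \sum_s phi2 s + \sum_s phi3 s)
    + (\sum_s nu1 s + \sum_s nu2 s + \sum_s nu3 s).
Proof.
move=> h1 h2 h3.
have key : 0 <= (\sum_s rip (phi1 s) (phi2 s) + \sum_s rip (phi2 s) (phi3 s)
    + \sum_s rip (phi3 s) (phi1 s)) *+ 2 + (\sum_s nu1 s + \sum_s nu2 s + \sum_s nu3 s).
  rewrite -!big_split /= -sumrMnl -big_split /=; apply: sumr_ge0 => s _.
  have := nsq_ge0 (phi1 s + phi2 s + phi3 s); rewrite !nsqD ripDl (ripC (phi1 s) (phi3 s)).
  by have := h1 s; have := h2 s; have := h3 s; lra.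
rewrite /cross !nsqD ripDl (ripC (\sum_s phi1 s) (\sum_s phi3 s)).
have := nsq_ge0 (\sum_s phi1 s); have := nsq_ge0 (\sum_s phi2 s).
have := nsq_ge0 (\sum_s phi3 s); lra.
Qed.

Section Gap.
Variables (a b c : nat) (f : seq L -> H).

(** The squared lengths of the three edges that the relator xyz contributes to the
    link. *)
Definition link_energy (x y z : seq L) : R :=
  nsq (f z - f (inv_word y)) + nsq (f x - f (inv_word z)) + nsq (f y - f (inv_word x)).

Definition word_energy (x y z : seq L) : R := nsq (f x) + nsq (f y) + nsq (f z).

Definition reduced_nsq m : R := \sum_(x : m.-tuple L | reduced x) nsq (f x).

Definition total_mean : H :=
  \sum_s mean_from f a s + \sum_s mean_from f b s + \sum_s mean_from f c s.

Definition total_mean_nsq : R :=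
  \sum_s mean_nsq_from f a s + \sum_s mean_nsq_from f b s + \sum_s mean_nsq_from f c s.

Lemma triple_sumD d1 d2 d3 (F G : seq L -> seq L -> seq L -> R) :
  triple_sum d1 d2 d3 (fun x y z => F x y z + G x y z) =
  triple_sum d1 d2 d3 F + triple_sum d1 d2 d3 G.
Proof.
rewrite /triple_sum -big_split; apply: eq_bigr => x _; rewrite -big_split.
apply: eq_bigr => y _; rewrite -big_split; apply: eq_bigr => z _.
exact: mulrDr.
Qed.

Lemma reduced_nsqE m : reduced_nsq m.+1 = q ^+ m * \sum_s mean_nsq_from f m s.
Proof.
rewrite /reduced_nsq (sum_reduced_cons m (fun w => nsq (f w))) big_distrr.
apply: eq_bigr => s _; rewrite /= /mean_nsq_from mulrA divff ?mul1r //.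
by rewrite expf_neq0 // gt_eqF // growth_gt0.
Qed.

(** The factor 2q - 1 is 2q, from the degrees of the tripartite graph, minus the
    loss in [tripartite_form]. *)
Lemma link_energy_ge (d : R) : 0 <= d <= 1 -> q + 1 <= d * q ^+ a.+2 ->
  q + 1 <= d * q ^+ b.+2 -> q + 1 <= d * q ^+ c.+2 ->
  (1 - d) * (q ^+ 2 * q ^+ (a + b + c) / (q + 1)) *
    ((2 * q - 1) * total_mean_nsq - nsq total_mean) <=
  triple_sum a.+1 b.+1 c.+1 link_energy.
Proof.
move=> /andP[d0 d1] qa qb qc; have qp := growth_gt0; have q1 : 0 < q + 1 by lra.
pose P m n := q * (\sum_s mean_nsq_from f m s + \sum_s mean_nsq_from f n s)
   - cross (mean_from f m) (mean_from f n) *+ 2.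
have part m1 m2 m3 : q + 1 <= d * q ^+ m1.+2 ->
    (1 - d) * (q ^+ 2 * q ^+ (m1 + m2 + m3) / (q + 1)) * P m2 m3 <=
    triple_sum m1.+1 m2.+1 m3.+1 (fun _ y z => nsq (f z - f (inv_word y))).
  move=> qm; have := @triple_sum_last_ge R k k2 m1.+1 m2.+1 m3.+1
     (fun y z => nsq (f z - f (inv_word y))) isT (fun _ _ => nsq_ge0 _).
  apply: le_trans; rewrite -/(pair_sum f m2.+1 m3.+1).
  have S0 : 0 <= pair_sum f m2.+1 m3.+1.
    by apply: sumr_ge0 => y _; apply: sumr_ge0 => z _; rewrite mulr_ge0 ?nsq_ge0.
  have -> : (1 - d) * (q ^+ 2 * q ^+ (m1 + m2 + m3) / (q + 1)) * P m2 m3 =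
      (1 - d) * q ^+ m1.+2 / (q + 1) * pair_sum f m2.+1 m3.+1.
    by rewrite pair_sumE -/(P m2 m3) !exprD !exprS expr0; field; rewrite gt_eqF.
  apply: ler_wpM2r => //.
  have : 1 <= d * q ^+ m1.+2 / (q + 1) by rewrite ler_pdivlMr // mul1r.
  lra.
rewrite /link_energy !triple_sumD.
have h1 := part a b c qa.
have h2 := part b c a qb.
rewrite -(triple_sum_rot a.+1 b.+1 c.+1 (fun x _ z => nsq (f x - f (inv_word z)))) in h2.
have h3 := part c a b qc.
rewrite (triple_sum_rot c.+1 a.+1 b.+1) in h3.
apply: le_trans _ (lerD (lerD h1 h2) h3).
have -> : (b + c + a = a + b + c)%N by rewrite addnC addnA.
have -> : (c + a + b = a + b + c)%N by rewrite -addnA addnC.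
rewrite -!mulrDr; apply: ler_wpM2l.
  apply: mulr_ge0; first by rewrite subr_ge0.
  by apply: divr_ge0; [apply: mulr_ge0; apply/exprn_ge0/ltW | apply: ltW].
have := tripartite_form (mean_from_le f a) (mean_from_le f b) (mean_from_le f c).
rewrite -/total_mean -/total_mean_nsq /P /total_mean_nsq; lra.
Qed.

Lemma word_energy_le (d : R) : 0 <= d -> q + 1 <= d * q ^+ a.+2 ->
  q + 1 <= d * q ^+ b.+2 -> q + 1 <= d * q ^+ c.+2 ->
  triple_sum a.+1 b.+1 c.+1 word_energy <=
  (1 + d) * (q ^+ 2 * q ^+ (a + b + c) / (q + 1)) * (q * total_mean_nsq).
Proof.
move=> d0 qa qb qc; have q3 := growth_ge3 R k2; have qp := growth_gt0; have q1 : 0 < q + 1 by lra.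
have part m1 m2 m3 : q + 1 <= d * q ^+ m2.+2 ->
    triple_sum m1.+1 m2.+1 m3.+1 (fun x _ _ => nsq (f x)) <=
    (1 + d) * (q ^+ 2 * q ^+ (m1 + m2 + m3) / (q + 1)) * (q * \sum_s mean_nsq_from f m1 s).
  move=> qm; have f0 x : 0 <= nsq (f x) by apply: nsq_ge0.
  apply: le_trans (@triple_sum_first_le R k k2 m1.+1 m2.+1 m3.+1 _ isT f0) _.
  rewrite -/(reduced_nsq m1.+1) reduced_nsqE.
  have -> : (1 + d) * (q ^+ 2 * q ^+ (m1 + m2 + m3) / (q + 1)) * (q * \sum_s mean_nsq_from f m1 s)
     = (1 + d) * q ^+ (m2.+1 + m3.+1).+1 / (q + 1) * (q ^+ m1 * \sum_s mean_nsq_from f m1 s).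
    by rewrite addnS addSn !exprD !exprS expr0 !exprD; field; rewrite gt_eqF.
  apply: ler_wpM2r.
    by rewrite -reduced_nsqE; apply: sumr_ge0 => x _; apply: nsq_ge0.
  have : 1 <= d * q ^+ (m2.+1 + m3.+1).+1 / (q + 1).
    rewrite ler_pdivlMr // mul1r; apply: le_trans qm _; apply: ler_wpM2l => //.
    by apply: ler_weXn2l; [lra | lia].
  lra.
rewrite /word_energy !triple_sumD.
have h1 := part a b c qb.
have h2 := part b c a qc; rewrite -(triple_sum_rot a.+1 b.+1 c.+1 (fun _ y _ => nsq (f y))) in h2.
have h3 := part c a b qa.
rewrite (triple_sum_rot c.+1 a.+1 b.+1) in h3.
apply: le_trans (lerD (lerD h1 h2) h3) _.
have -> : (b + c + a = a + b + c)%N by rewrite addnC addnA.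
have -> : (c + a + b = a + b + c)%N by rewrite -addnA addnC.
by rewrite -!mulrDr.
Qed.

(** With relative errors of 1/24 the edges of the mean link weigh about
    2q - 1 >= (5/3) q against q for the displacements, and the total mean has to
    absorb the difference. *)
Lemma link_gap (rho theta : R) : 0 < rho -> 0 <= theta ->
  q + 1 <= 24^-1 * q ^+ a.+2 -> q + 1 <= 24^-1 * q ^+ b.+2 -> q + 1 <= 24^-1 * q ^+ c.+2 ->
  (forall m, m \in [:: a; b; c] ->
     theta * q ^+ m <= 24^-1 * (rho * (q ^+ 2 * q ^+ (a + b + c) / (q + 1))) * q) ->
  rho * (triple_sum a.+1 b.+1 c.+1 link_energy - triple_sum a.+1 b.+1 c.+1 word_energy) <=
    theta * (reduced_nsq a.+1 + reduced_nsq b.+1 + reduced_nsq c.+1) ->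
  q / 2 * total_mean_nsq <= nsq total_mean.
Proof.
move=> r0 th0 qa qb qc thq dev.
have d0 : 0 <= 24^-1 :> R by lra.
have d01 : 0 <= (24^-1 : R) <= 1 by apply/andP; split; lra.
have lo := link_energy_ge d01 qa qb qc; have up := word_energy_le d0 qa qb qc.
set Z := q ^+ 2 * _ / _ in thq lo up.
have qp := growth_gt0.
have Z0 : 0 < Z by apply: divr_gt0; [apply: mulr_gt0; apply: exprn_gt0 | lra].
have mn m : 0 <= \sum_s mean_nsq_from f m s.
  apply: sumr_ge0 => s _; apply: mulr_ge0.
    by rewrite invr_ge0; apply/exprn_ge0/ltW.
  by apply: sumr_ge0 => x _; apply: nsq_ge0.
have red m : m \in [:: a; b; c] ->
    theta * reduced_nsq m.+1 <= 24^-1 * (rho * Z) * q * \sum_s mean_nsq_from f m s.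
  by move=> mabc; rewrite reduced_nsqE mulrA; apply: ler_wpM2r => //; apply: thq.
have ra := red a (mem_head _ _); have rb : _ := red b ltac:(by rewrite !inE eqxx orbT).
have rc : _ := red c ltac:(by rewrite !inE eqxx !orbT).
have nu0 : 0 <= total_mean_nsq by rewrite !addr_ge0.
have dev2 : theta * (reduced_nsq a.+1 + reduced_nsq b.+1 + reduced_nsq c.+1) <=
    24^-1 * (rho * Z) * q * total_mean_nsq.
  rewrite /total_mean_nsq [X in X <= _]mulrDr [theta * (_ + _)]mulrDr [leRHS]mulrDr.
  by rewrite [X in _ <= X + _]mulrDr !lerD.
have := le_trans dev dev2.
have lo2 := ler_wpM2l (ltW r0) lo; have up2 := ler_wpM2l (ltW r0) up.
rewrite mulrBr => h; have rZ : 0 < rho * Z by rewrite mulr_gt0.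
move: nu0 lo2 up2 h; move: total_mean_nsq (nsq total_mean) => nu n nu0 lo2 up2 h.
have {lo2 up2 h} : rho * Z * ((1 - 24^-1) * ((2 * q - 1) * nu - n)) <=
   rho * Z * ((1 + 24^-1) * (q * nu) + 24^-1 * q * nu) by lra.
rewrite (ler_pM2l rZ) => h.
have := growth_ge3 R k2 => q3; have : 0 <= (q - 3) * nu by rewrite mulr_ge0 // subr_ge0.
lra.
Qed.

End Gap.

End LinkForm.

(** * The link graph *)

Section LinkGraph.
Variables (R : realType) (k a b c : nat).
Hypothesis k2 : (2 <= k)%N.
Local Notation L := (letter k).
Local Notation q := (growth R k).
Local Notation T := (relator k (a.+1 + (b.+1 + c.+1))).

Definition vertex : finType := (a.+1.-tuple L + b.+1.-tuple L + c.+1.-tuple L)%type.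

Definition vertex_word (v : vertex) : seq L :=
  match v with inl (inl x) => x | inl (inr y) => y | inr z => z end.

Definition inv_vertex (v : vertex) : vertex :=
  match v with
  | inl (inl x) => inl (inl (inv_tuple x))
  | inl (inr y) => inl (inr (inv_tuple y))
  | inr z => inr (inv_tuple z)
  end.

Lemma inv_vertexK : involutive inv_vertex.
Proof. by case=> [[x|y]|z] /=; rewrite inv_tupleK. Qed.

Definition word1 (t : T) : seq L := take a.+1 (val (val t)).
Definition word2 (t : T) : seq L := take b.+1 (drop a.+1 (val (val t))).
Definition word3 (t : T) : seq L := drop b.+1 (drop a.+1 (val (val t))).

Lemma size_word1 t : size (word1 t) == a.+1.
Proof. by rewrite size_takel // size_tuple leq_addr. Qed.
Lemma size_word2 t : size (word2 t) == b.+1.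
Proof. by rewrite size_takel // size_drop size_tuple addKn leq_addr. Qed.
Lemma size_word3 t : size (word3 t) == c.+1.
Proof. by rewrite !size_drop size_tuple !addKn. Qed.

Lemma word_cat t : word1 t ++ word2 t ++ word3 t = val (val t).
Proof. by rewrite /word1 /word2 /word3 !cat_take_drop. Qed.

Lemma cyclically_reduced_reduced (w : seq L) : cyclically_reduced w -> reduced w.
Proof. by case: w => // x s; rewrite /cyclically_reduced /= rcons_path => /andP[]. Qed.

Lemma reduced_words t : [/\ reduced (word1 t), reduced (word2 t) & reduced (word3 t)].
Proof.
have : reduced (word1 t ++ word2 t ++ word3 t).
  by rewrite word_cat; apply: cyclically_reduced_reduced (valP t).
by rewrite /reduced => /cat_sorted2[-> /cat_sorted2[-> ->]].
Qed.

Definition part1 (t : T) : vertex := inl (inl (Tuple (size_word1 t))).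
Definition part2 (t : T) : vertex := inl (inr (Tuple (size_word2 t))).
Definition part3 (t : T) : vertex := inr (Tuple (size_word3 t)).

(** The arcs carrying the difference between [word_energy] and [link_energy] of a
    relator: expanding the squared lengths of the three edges cancels
    [word_energy] up to loops at the inverse parts, and leaves the cross terms of
    the edges, listed here in both directions. *)
Definition link_arcs (t : T) : seq (vertex * vertex) :=
  let x := part1 t in let y := part2 t in let z := part3 t in
  let x' := inv_vertex x in let y' := inv_vertex y in let z' := inv_vertex z in
  [:: (x', x'); (y', y'); (z', z'); (z, y'); (x, z'); (y, x'); (y', z); (z', x); (x', y)].

Definition link_src (t : T) (j : 'I_9) : vertex := (nth (part1 t, part1 t) (link_arcs t) j).1.
Definition link_tgt (t : T) (j : 'I_9) : vertex := (nth (part1 t, part1 t) (link_arcs t) j).2.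
Definition link_coef (j : 'I_9) : R := if (j < 3)%N then -1 else 1.

Lemma link_coef_le1 j : `|link_coef j| <= 1.
Proof. by rewrite /link_coef; case: ifP => _; rewrite ?normrN normr1. Qed.

(** Reverses the six proper arcs, which makes the random kernel symmetric. *)
Definition flip_arc (j : 'I_9) : 'I_9 :=
  if (j < 3)%N then j else if (j < 6)%N then inord (j + 3) else inord (j - 3).

Lemma flip_arcK : involutive flip_arc.
Proof.
move=> j; apply/val_inj; case: j => m; do 9?[case: m => [|m] //];
  by move=> i; rewrite /flip_arc /= ?inordK //= ?inordK.
Qed.

Lemma link_flip t j :
  [/\ link_src t (flip_arc j) = link_tgt t j, link_tgt t (flip_arc j) = link_src t j &
      link_coef (flip_arc j) = link_coef j].
Proof.
rewrite /link_src /link_tgt /link_coef.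
case: j => m; do 9?[case: m => [|m] //];
  by move=> i; rewrite /flip_arc /= ?inordK.
Qed.

Variable M : R.
Hypothesis count1 : q ^+ (b.+1 + c.+1).+1 / (q + 1) + 1 <= M.
Hypothesis count2 : q ^+ (c.+1 + a.+1).+1 / (q + 1) + 1 <= M.
Hypothesis count3 : q ^+ (a.+1 + b.+1).+1 / (q + 1) + 1 <= M.

Lemma count_first_le d e m (x : seq L) :
  q ^+ (e + m).+1 / (q + 1) + 1 <= M ->
  triple_sum d.+1 e m (fun w _ _ => (w == x)%:R) <= M.
Proof.
move=> hM; have qp := growth_gt0 R k2; have n0 : 0 <= q ^+ (e + m).+1 / (q + 1) + 1.
  by rewrite addr_ge0 // divr_ge0 ?exprn_ge0 // ?ltW //; lra.
apply: le_trans (@triple_sum_first_le R k k2 d.+1 e m (fun w => (w == x)%:R) isT _) _ => //.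
apply: le_trans hM; rewrite -[leRHS]mulr1; apply: ler_wpM2l => //.
have [sx|sx] := boolP (size x == d.+1); last first.
  rewrite big1 // => w _; case: eqP => // wx.
  by rewrite -wx size_tuple eqxx in sx.
rewrite big_mkcond (bigD1 (Tuple sx)) //= big1 ?addr0; first by case: ifP => _; rewrite ?eqxx.
by move=> w wx; case: ifP => // _; case: eqP => // e1; case/eqP: wx; apply: val_inj.
Qed.

Lemma count_bound_ge0 : 0 <= M.
Proof.
apply: le_trans (@count_first_le a _ _ [::] count1).
by do 3!apply: sumr_ge0 => ? _; rewrite mulr_ge0.
Qed.

Lemma count_part1 v : \sum_t (part1 t == v)%:R <= M.
Proof.
have M0 := count_bound_ge0.
case: v => [[x|y]|z]; try by rewrite big1.
apply: le_trans (@count_first_le a _ _ x count1).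
rewrite -relator_sum; apply: ler_sum => t _.
by rewrite /part1 -[_ == _]/(word1 t == x).
Qed.

Lemma count_part2 v : \sum_t (part2 t == v)%:R <= M.
Proof.
have M0 := count_bound_ge0.
case: v => [[x|y]|z]; try by rewrite big1.
apply: le_trans (@count_first_le b _ _ y count2).
rewrite -(triple_sum_rot a.+1 b.+1 c.+1 (fun _ w _ => (w == val y)%:R)).
rewrite -relator_sum; apply: ler_sum => t _.
by rewrite /part2 -[_ == _]/(word2 t == y).
Qed.

Lemma count_part3 v : \sum_t (part3 t == v)%:R <= M.
Proof.
have M0 := count_bound_ge0.
case: v => [[x|y]|z]; try by rewrite big1.
apply: le_trans (@count_first_le c _ _ z count3).
rewrite (triple_sum_rot c.+1 a.+1 b.+1 (fun w _ _ => (w == val z)%:R)).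
rewrite -relator_sum; apply: ler_sum => t _.
by rewrite /part3 -[_ == _]/(word3 t == z).
Qed.

(** In each of the nine positions a vertex is a part of a relator, or the inverse
    of one, so the number of relators with a given part bounds its multiplicity. *)
Lemma link_in_degree v :
  #|[set x : T * 'I_9 | link_tgt x.1 x.2 == v]|%:R <= 9 * M.
Proof.
rewrite -sum1_card natr_sum big_mkcond /=.
rewrite (eq_bigr (fun x : T * 'I_9 => (link_tgt x.1 x.2 == v)%:R)); last first.
  by move=> x _; rewrite inE; case: ifP.
rewrite -(pair_big xpredT xpredT (fun t j => (link_tgt t j == v)%:R)) /= exchange_big /=.
apply: le_trans (_ : \sum_(j < 9) M <= _); last by rewrite sumr_const card_ord mulr_natl.
apply: ler_sum => j _.
have inv (p : T -> vertex) : (forall w, \sum_t (p t == w)%:R <= M) ->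
    \sum_t (inv_vertex (p t) == v)%:R <= M.
  move=> /(_ (inv_vertex v)); apply: le_trans; apply: ler_sum => t _.
  by rewrite (can2_eq inv_vertexK inv_vertexK).
case: j => m; do 9?[case: m => [|m]]; move=> i //;
  rewrite /link_tgt /link_arcs /=;
  first [exact: count_part1 | exact: count_part2 | exact: count_part3
       | exact: inv count_part1 | exact: inv count_part2 | exact: inv count_part3].
Qed.

End LinkGraph.

(** * The Laplacian of a word action *)

Section WordAction.
Local Open Scope complex_scope.
Variables (R : realType) (k a b c : nat).
Hypothesis k2 : (2 <= k)%N.
Local Notation L := (letter k).
Local Notation q := (growth R k).
Local Notation T := (relator k (a.+1 + (b.+1 + c.+1))).
Variables (H : hilbertSpace R) (act : seq L -> H -> H).
Hypothesis actB : forall w u v, act w (u - v) = act w u - act w v.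
Hypothesis actZ : forall w (x : R) v, act w (x%:C *: v) = x%:C *: act w v.
Hypothesis act_cat : forall x y v, act (x ++ y) v = act x (act y v).
Hypothesis act_inv : forall w v, act (inv_word w) (act w v) = v.
Hypothesis act_rip : forall w u v, rip (act w u) (act w v) = rip u v.

Lemma act_invr w v : act w (act (inv_word w) v) = v.
Proof. by rewrite -{1}[w]inv_wordK act_inv. Qed.

Lemma act_nsq w v : nsq (act w v) = nsq v.
Proof. exact: act_rip. Qed.

Lemma rip_act_inv w u v : rip (act w u) v = rip u (act (inv_word w) v).
Proof. by rewrite -(act_rip w u) act_invr. Qed.

Definition displacement v (w : seq L) : H := act w v - v.

(** Applying the isometry xy to z v - y^-1 v gives v - x v. *)
Lemma triangle_nsq x y z v : (forall u, act (x ++ y ++ z) u = u) ->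
  nsq (displacement v z - displacement v (inv_word y)) = nsq (displacement v x).
Proof.
move=> xyz; rewrite /displacement opprB subrKA.
rewrite -(act_nsq y) actB act_invr -(act_nsq x) actB -!act_cat -?catA xyz.
by rewrite -nsqN opprB.
Qed.

Lemma act_rot x y v : (forall u, act (x ++ y) u = u) -> act (y ++ x) v = v.
Proof.
by move=> xy; rewrite act_cat -[LHS](act_inv x) -(act_cat x) xy act_inv.
Qed.

(** Cyclic rotations of a trivial relator are trivial, so [triangle_nsq] applies
    to each edge of the link. *)
Lemma trivial_relator_energy x y z v : (forall u, act (x ++ y ++ z) u = u) ->
  link_energy (displacement v) x y z = word_energy (displacement v) x y z.
Proof.
move=> xyz; rewrite /link_energy /word_energy.
have yzx u : act (y ++ z ++ x) u = u by rewrite catA; apply: act_rot.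
have zxy u : act (z ++ x ++ y) u = u by rewrite catA; apply: act_rot.
by rewrite (triangle_nsq v xyz) (triangle_nsq v yzx) (triangle_nsq v zxy); ring.
Qed.

(** One minus the average over the sphere of reduced words of length m + 1, which
    has (q + 1) q^m elements. *)
Definition sphere_laplacian m v : H :=
  (((q + 1) * q ^+ m)^-1)%:C *: \sum_(w : m.+1.-tuple L | reduced w) (v - act w v).

Definition laplacian v : H := sphere_laplacian a v + sphere_laplacian b v + sphere_laplacian c v.

Definition sphere_energy m v : R :=
  ((q + 1) * q ^+ m)^-1 * reduced_nsq (displacement v) m.+1.

Let q_gt0 : 0 < q. Proof. exact: growth_gt0. Qed.
Let q1_gt0 : 0 < q + 1. Proof. by have := q_gt0; lra. Qed.
Let vol_gt0 m : 0 < (q + 1) * q ^+ m.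
Proof. by rewrite mulr_gt0 // exprn_gt0. Qed.

Lemma card_reduced m : #|[pred w : m.+1.-tuple L | reduced w]|%:R = (q + 1) * q ^+ m.
Proof.
rewrite -sum1_card natr_sum (sum_reduced_cons m (fun=> 1)).
under eq_bigr do rewrite sumr_const card_path //.
by rewrite sumr_const -(card_letter R k) mulr_natl.
Qed.

Lemma sphere_laplacianB m u v :
  sphere_laplacian m (u - v) = sphere_laplacian m u - sphere_laplacian m v.
Proof.
rewrite /sphere_laplacian -scalerBr -sumrB; congr (_ *: _); apply: eq_bigr => w _.
by rewrite actB opprD addrACA -opprD.
Qed.

Lemma sphere_laplacianZ m (x : R) v :
  sphere_laplacian m (x%:C *: v) = x%:C *: sphere_laplacian m v.
Proof.
rewrite /sphere_laplacian scalerA [x%:C * _]mulrC -scalerA; congr (_ *: _).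
by rewrite scaler_sumr; apply: eq_bigr => w _; rewrite actZ scalerBr.
Qed.

(** The sphere is stable under inversion, and the inverse word acts by the adjoint
    isometry. *)
Lemma sphere_laplacian_sym m u v :
  rip (sphere_laplacian m u) v = rip u (sphere_laplacian m v).
Proof.
rewrite ripZl ripZr; congr (_ * _); rewrite rip_suml rip_sumr.
rewrite [RHS](reindex_inj (inv_inj (@inv_tupleK k m.+1))) /=.
apply: eq_big => [w|w _]; first by rewrite reduced_inv.
by rewrite ripBl ripBr rip_act_inv.
Qed.

Lemma sphere_laplacian_energy m v : 2 * rip (sphere_laplacian m v) v = sphere_energy m v.
Proof.
rewrite ripZl mulrCA; congr (_ * _); rewrite rip_suml mulr_sumr.
apply: eq_bigr => w _; rewrite ripBl /displacement nsqB act_nsq -/(nsq v); ring.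
Qed.

Lemma sphere_laplacian_le m v : nsq (sphere_laplacian m v) <= sphere_energy m v.
Proof.
rewrite nsqZ /sphere_energy expr2 -mulrA; apply: ler_wpM2l; first by rewrite invr_ge0 ltW.
apply: le_trans (ler_wpM2l _ (nsq_sum_le _ _)) _; first by rewrite invr_ge0 ltW.
rewrite (card_reduced m) mulKf ?gt_eqF //.
by apply: ler_sum => w _; rewrite /displacement -nsqN opprB.
Qed.

Lemma sphere_energy_le m v (d : R) :
  (forall w : m.+1.-tuple L, nsq (displacement v w) <= d) -> sphere_energy m v <= d.
Proof.
move=> hd; rewrite /sphere_energy ler_pdivrMl //.
apply: le_trans (ler_sum _ (fun w _ => hd w)) _.
by rewrite sumr_const -mulr_natl (card_reduced m).
Qed.

Lemma sphere_energy_ge0 m v : 0 <= sphere_energy m v.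
Proof.
apply: mulr_ge0; first by rewrite invr_ge0 ltW.
by apply: sumr_ge0 => w _; exact: nsq_ge0.
Qed.

Lemma sphere_energyE m v :
  sphere_energy m v = (q + 1)^-1 * \sum_s mean_nsq_from (displacement v) m s.
Proof.
by rewrite /sphere_energy reduced_nsqE // invfM -mulrA mulKf // expf_neq0 // gt_eqF.
Qed.

Lemma sphere_laplacianE m v : sphere_laplacian m v =
  (- (q + 1)^-1)%:C *: \sum_s mean_from (displacement v) m s.
Proof.
rewrite /sphere_laplacian (sum_reduced_cons m (fun w => v - act w v)) -scaler_sumr.
rewrite invfM rmorphM -scalerA rmorphN scaleNr -scalerN -scalerN -sumrN.
do 2!congr (_ *: _); apply: eq_bigr => s _; rewrite -sumrN; apply: eq_bigr => w _.
by rewrite /displacement opprB.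
Qed.

Lemma laplacian_energy v :
  2 * energy laplacian v = sphere_energy a v + sphere_energy b v + sphere_energy c v.
Proof. by rewrite /energy /laplacian !ripDl !mulrDr !sphere_laplacian_energy. Qed.

Hypothesis gap : forall v, q / 2 * total_mean_nsq a b c (displacement v) <=
  nsq (total_mean a b c (displacement v)).

(** In terms of the total mean, the inequality from the link reads
    (q + 1) |Delta v|^2 >= q <Delta v, v>. *)
Lemma laplacian_gap v : energy laplacian v <= 2 * nsq (laplacian v).
Proof.
have -> : laplacian v = (- (q + 1)^-1)%:C *: total_mean a b c (displacement v).
  by rewrite /laplacian !sphere_laplacianE /total_mean !scalerDr.
rewrite nsqZ sqrrN -(ler_pM2l (ltr0n R 2 : 0 < 2%N%:R)) laplacian_energy !sphere_energyE -!mulrDr.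
rewrite -/(total_mean_nsq a b c (displacement v)).
have := gap v; set nu := total_mean_nsq _ _ _ _; set n := nsq _ => g.
rewrite exprVn.
rewrite ler_pdivrMl //.
have -> : (q + 1) * (2 * (2 * (((q + 1) ^+ 2)^-1 * n))) = 4 * n / (q + 1).
  by field; rewrite gt_eqF.
rewrite ler_pdivlMr // mulrC.
have nu0 : 0 <= nu.
  rewrite /nu /total_mean_nsq !addr_ge0 //; apply: sumr_ge0 => s _;
    exact: le_trans (nsq_ge0 _) (mean_from_le k2 _ _ _).
have := growth_ge3 R k2; nra.
Qed.

(** The energy is a sum of squared displacements over the three spheres, so the
    limit of the descent is fixed by every word on them. *)
Lemma near_fixed_vector v :
  exists2 w, (forall m x, m \in [:: a; b; c] -> size x = m.+1 -> reduced x -> act x w = w) &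
    rnorm (w - v) <= 13 * Num.sqrt (energy laplacian v).
Proof.
have [||||||w w0 wv] := @gradient_descent R H laplacian _ _ _ _ _ _ laplacian_gap v.
- move=> u1 u2; rewrite /laplacian !sphere_laplacianB !opprD [RHS]addrACA; congr (_ + _).
  exact: addrACA.
- by move=> x u; rewrite /laplacian !sphere_laplacianZ !scalerDr.
- by move=> u1 u2; rewrite /laplacian !ripDl !ripDr !sphere_laplacian_sym.
- move=> u; rewrite -(pmulr_rge0 _ (ltr0n R 2 : 0 < 2%N%:R)) laplacian_energy.
  by rewrite !addr_ge0 ?sphere_energy_ge0.
- move=> u; have bound m : sphere_energy m u <= 4 * nsq u.
    apply: sphere_energy_le => w; apply: le_trans (nsqD_le _ _) _.
    by rewrite act_nsq nsqN; lra.
  by have := laplacian_energy u; have := bound a; have := bound b; have := bound c; lra.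
- move=> u; have := laplacian_energy u.
  have := sphere_laplacian_le a u; have := sphere_laplacian_le b u.
  have := sphere_laplacian_le c u; rewrite /laplacian.
  move: (sphere_laplacian a u) (sphere_laplacian b u) (sphere_laplacian c u) => x y z.
  rewrite !nsqD ripDl; have := rip_le x y; have := rip_le x z; have := rip_le y z; lra.
exists w => // m x mabc sx rx.
have e0 : sphere_energy m w = 0.
  have := laplacian_energy w; rewrite w0 mulr0.
  have := sphere_energy_ge0 a w; have := sphere_energy_ge0 b w; have := sphere_energy_ge0 c w.
  by move: mabc; rewrite !inE => /or3P[]/eqP ->; lra.
have /eqP : reduced_nsq (displacement w) m.+1 = 0.
  by apply/eqP; move/eqP: e0; rewrite /sphere_energy mulf_eq0 invr_eq0 (gt_eqF (vol_gt0 m)).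
rewrite psumr_eq0 => [/allP|y _]; last exact: nsq_ge0.
have sx' : size x == m.+1 by rewrite sx.
move=> /(_ (Tuple sx') (mem_index_enum _)); rewrite /= rx /= nsq_eq0 subr_eq0.
by move=> /eqP.
Qed.

End WordAction.

(** * Deviation of the link from its mean *)

Section Deviation.
Local Open Scope complex_scope.
Variables (R : realType) (k a b c : nat).
Local Notation L := (letter k).
Local Notation T := (relator k (a.+1 + (b.+1 + c.+1))).
Variables (A : {set T}) (p theta : R) (j : nat).
Hypothesis theta0 : 0 < theta.

Definition link_kernel : vertex k a b c -> vertex k a b c -> R :=
  random_kernel (@link_src k a b c) (@link_tgt k a b c) (@link_coef R) p A.

Lemma link_kernel_sym u v : link_kernel u v = link_kernel v u.
Proof.
rewrite /link_kernel /random_kernel /arc_kernel.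
rewrite (reindex_inj (inv_inj (f := fun x : T * 'I_9 => (x.1, flip_arc x.2)) _)); last first.
  by move=> [t i] /=; rewrite flip_arcK.
apply: eq_bigr => -[t i] _ /=.
by have [-> -> ->] := link_flip R t i; rewrite andbC.
Qed.

Variable H : hilbertSpace R.

Lemma arc_kernel_form (T' J V : finType) (src tgt : T' -> J -> V) (w : T' * J -> R) (h : V -> H) :
  kernel_form (H := H) h (arc_kernel src tgt w) =
  \sum_t \sum_i w (t, i) * rip (h (src t i)) (h (tgt t i)).
Proof.
rewrite /kernel_form /arc_kernel.
under eq_bigr => u _ do under eq_bigr => v _ do rewrite big_distrl /=.
under eq_bigr do rewrite exchange_big /=.
rewrite exchange_big [RHS]pair_big /=; apply: eq_bigr => -[t i] _ /=.
rewrite (bigD1 (src t i)) //= [X in _ + X]big1 ?addr0; last first.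
  by move=> u /negbTE su; apply: big1 => v _; rewrite eq_sym su mul0r.
rewrite (bigD1 (tgt t i)) //= [X in _ + X]big1 ?addr0; last first.
  by move=> v /negbTE tv; rewrite [tgt t i == v]eq_sym tv andbF mul0r.
by rewrite !eqxx.
Qed.

Variable f : seq L -> H.

Definition reduced_value (u : vertex k a b c) : H :=
  if reduced (vertex_word u) then f (vertex_word u) else 0.

Lemma total_nsq_reduced :
  total_nsq reduced_value = reduced_nsq f a.+1 + reduced_nsq f b.+1 + reduced_nsq f c.+1.
Proof.
have Z (x : bool) (v : H) : nsq (if x then v else 0) = if x then nsq v else 0.
  by case: x => //; apply/eqP; rewrite nsq_eq0.
rewrite /total_nsq !big_sumType /= /reduced_value /=.
by congr (_ + _ + _); rewrite /reduced_nsq [RHS]big_mkcond; apply: eq_bigr => x _; rewrite Z.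
Qed.

(** On functions supported on the reduced words the random kernel computes the
    fluctuation of [word_energy] minus [link_energy]. *)
Lemma link_kernel_form : kernel_form reduced_value link_kernel =
  \sum_(t : T) centred p A t *
    (word_energy f (word1 t) (word2 t) (word3 t) - link_energy f (word1 t) (word2 t) (word3 t)).
Proof.
rewrite /link_kernel /random_kernel arc_kernel_form; apply: eq_bigr => t _.
have [r1 r2 r3] := reduced_words t.
have i1 : reduced (inv_word (word1 t)) by rewrite reduced_inv.
have i2 : reduced (inv_word (word2 t)) by rewrite reduced_inv.
have i3 : reduced (inv_word (word3 t)) by rewrite reduced_inv.
rewrite !big_ord_recl big_ord0 /link_src /link_tgt /link_coef /= /reduced_value /=.
rewrite r1 r2 r3 i1 i2 i3 /word_energy /link_energy !nsqB.
rewrite -!/(nsq _) (ripC (f (inv_word (word2 t)))) (ripC (f (inv_word (word3 t)))).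
rewrite (ripC (f (inv_word (word1 t)))).
ring.
Qed.

Hypothesis trace_bound : kernel_trace (kernel_pow link_kernel (2 ^ j.+1)) <= theta ^+ (2 ^ j.+1).
Hypothesis trivial_energy : forall t, t \in A ->
  link_energy f (word1 t) (word2 t) (word3 t) = word_energy f (word1 t) (word2 t) (word3 t).

(** For the relators in A the two energies agree, so the sum with the centred
    weights is p times the opposite of the sum over all relators. *)
Lemma link_deviation :
  p * (triple_sum a.+1 b.+1 c.+1 (link_energy f) - triple_sum a.+1 b.+1 c.+1 (word_energy f)) <=
  theta * (reduced_nsq f a.+1 + reduced_nsq f b.+1 + reduced_nsq f c.+1).
Proof.
rewrite -total_nsq_reduced.
apply: le_trans (kernel_form_le reduced_value link_kernel_sym theta0 trace_bound).
rewrite link_kernel_form -!relator_sum -sumrB mulr_sumr; apply: ler_sum => t _.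
rewrite -/(word1 t) -/(word2 t) -/(word3 t) /centred.
have [tA|tA] := boolP (t \in A); last by rewrite sub0r; lra.
by rewrite trivial_energy // !subrr !mulr0.
Qed.

End Deviation.

(** * Words acting through a presentation *)

Section Presentation.
Local Open Scope complex_scope.
Variables (R : realType) (k : nat) (S : seq (letter k) -> Prop).
Variables (H : hilbertSpace R) (rep : unitary_rep (presented_group S) H).
Local Notation L := (letter k).
Local Open Scope quotient_scope.

Definition word_act (w : seq L) (v : H) : H := rep (\pi_(presented_group S) w) v.

Lemma word_act_cat x y v : word_act (x ++ y) v = word_act x (word_act y v).
Proof. rewrite /word_act -repM; congr (rep _ v); exact/esym/presented_mul_pi. Qed.

Lemma word_act_nil v : word_act [::] v = v.
Proof. exact: (rep1 rep). Qed.

Lemma word_act_equiv x y v : word_equiv S x y -> word_act x v = word_act y v.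
Proof. by move=> xy; rewrite /word_act; congr (rep _ _); apply/eqP/word_equivP. Qed.

Lemma word_act_inv w v : word_act (inv_word w) (word_act w v) = v.
Proof.
by rewrite -word_act_cat (word_act_equiv _ (word_equiv_invl S w)) word_act_nil.
Qed.

Lemma word_actB w u v : word_act w (u - v) = word_act w u - word_act w v.
Proof. exact: raddfB. Qed.

Lemma word_actD w u v : word_act w (u + v) = word_act w u + word_act w v.
Proof. exact: raddfD. Qed.

Lemma word_actZ w (x : R) v : word_act w (x%:C *: v) = x%:C *: word_act w v.
Proof. exact: linearZ. Qed.

Lemma word_act_rip w u v : rip (word_act w u) (word_act w v) = rip u v.
Proof. by rewrite /rip rep_inner. Qed.

Lemma rnorm_word_act w u : rnorm (word_act w u) = rnorm u.
Proof. by rewrite /rnorm /nsq word_act_rip. Qed.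

Lemma invariant_from_letters v : (forall s, word_act [:: s] v = v) ->
  forall g, rep g v = v.
Proof.
move=> inv; elim/presented_ind => w; rewrite -/(word_act w v).
elim: w => [|s w IH]; first exact: word_act_nil.
by rewrite -cat1s word_act_cat IH inv.
Qed.

Lemma displacement_le (e : R) v : 0 <= e ->
  (forall s, rnorm (word_act [:: s] v - v) <= e) ->
  forall w, rnorm (word_act w v - v) <= (size w)%:R * e.
Proof.
move=> e0 letters; elim=> [|s w IH].
  by rewrite word_act_nil subrr mul0r /rnorm /nsq rip0l sqrtr0.
rewrite -cat1s word_act_cat -(subrKA (word_act [:: s] v)) -word_actB.
apply: (@le_trans _ _ (rnorm (word_act [:: s] (word_act w v - v)) + rnorm (word_act [:: s] v - v))).
  exact: rnormD.
rewrite rnorm_word_act.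
apply: le_trans (lerD IH (letters s)) _.
by rewrite /= -[in leRHS]addn1 natrD mulrDl mul1r.
Qed.

(** If r^m s is reduced then it fixes v, so that s v = r^-m v; two letters s and t
    can be preceded by the powers of a common letter r.  The image need not be v
    itself: when the three lengths are even, v may be fixed by the words of even
    length only. *)
Lemma fixed_by_sphere m v (k2 : (2 <= k)%N) :
  (forall x, size x = m.+1 -> reduced x -> word_act x v = v) ->
  forall s t, word_act [:: s] v = word_act [:: t] v.
Proof.
move=> fix_v s t.
(* There are at least four letters, and only two are excluded. *)
have [r rs rt] : exists2 r : L, r != inv_letter s & r != inv_letter t.
  have : (0 < #|~: [set inv_letter s; inv_letter t]|)%N.
    have := cardsC [set inv_letter s; inv_letter t].
    rewrite card_prod card_ord card_bool cards2 => e; lia.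
  by rewrite card_gt0 => /set0Pn [r]; rewrite !inE negb_or => /andP[]; exists r.
pose u := nseq m r.
have step x : r != inv_letter x -> word_act [:: x] v = word_act (inv_word u) v.
  move=> rx; rewrite -{2}(fix_v (u ++ [:: x])).
  - by rewrite word_act_cat word_act_inv.
  - by rewrite size_cat size_nseq addn1.
  - have rr : r != inv_letter r by case: (r) => i [] /=; rewrite /inv_letter /= xpair_eqE andbF.
    rewrite /u /reduced; case: m {u fix_v} => // m; rewrite /= cats1 rcons_path.
    have -> : last r (nseq m r) = r by elim: m.
    rewrite compat_sym /compat rx andbT; elim: m => //= m ->.
    by rewrite /compat rr.
by rewrite (step s rs) (step t rt).
Qed.

End Presentation.

(** * Property (T) *)

Section PropertyT.
Local Open Scope complex_scope.
Variables (R : realType) (k a b c : nat).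
Hypothesis k2 : (2 <= k)%N.
Local Notation L := (letter k).
Local Notation q := (growth R k).
Local Notation l := (a.+1 + (b.+1 + c.+1))%N.

(** The letters form the Kazhdan set: a word of length at most l moves v by at most
    l times what the letters do, so an almost invariant v has small energy. *)
Lemma property_T_of_trace (A : {set relator k l}) (p theta : R) (j : nat) :
  0 < p -> 0 < theta ->
  q + 1 <= 24^-1 * q ^+ a.+2 -> q + 1 <= 24^-1 * q ^+ b.+2 -> q + 1 <= 24^-1 * q ^+ c.+2 ->
  (forall m, m \in [:: a; b; c] ->
     theta * q ^+ m <= 24^-1 * (p * (q ^+ 2 * q ^+ (a + b + c) / (q + 1))) * q) ->
  kernel_trace (kernel_pow (link_kernel A p) (2 ^ j.+1)) <= theta ^+ (2 ^ j.+1) ->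
  property_T R (random_group A).
Proof.
move=> p0 th0 qa qb qc thq tr.
pose S w := exists2 r : relator k l, r \in A & w = val (val r).
have l0 : 1 <= l%:R :> R by rewrite ler1n.
(* Any e < 2/105 would do: w lies within 26 e |v| of v, so w' = - w would give
   2 (1 - 26 e) |v| <= 2 |w| = |w' - w| <= 53 e |v|. *)
have [e e0 e64] : exists2 e : R, 0 < e & e * 64 = 1.
  by exists (64^-1); [rewrite invr_gt0 ltr0n | rewrite mulVf // pnatr_eq0].
pose eps : R := e / l%:R.
have le : l%:R * eps = e by rewrite /eps mulrC divfK // gt_eqF //; lra.
have eps0 : 0 < eps by rewrite divr_gt0 //; lra.
have eps_e : eps <= e by rewrite -le ler_peMl // ltW.
exists [seq (\pi_(presented_group S) [:: s])%qT | s <- enum L], eps; split=> // H rep [v vn almost].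
have v0 : 0 < rnorm v.
  by rewrite sqrtr_gt0 lt_def nsq_eq0 vn nsq_ge0.
have letters s : rnorm (word_act rep [:: s] v - v) <= eps * rnorm v.
  have := almost (\pi_(presented_group S) [:: s])%qT.
  rewrite map_f ?mem_enum // => /(_ isT).
  by rewrite !rnormE -rmorphM ltcR => /ltW.
have move_le := displacement_le (ltW (mulr_gt0 eps0 v0)) letters.
have gap u : q / 2 * total_mean_nsq a b c (displacement (word_act rep) u) <=
    nsq (total_mean a b c (displacement (word_act rep) u)).
  apply: (link_gap k2 p0 (ltW th0) qa qb qc thq).
  apply: (link_deviation th0 tr) => t tA.
  apply: (trivial_relator_energy (word_actB rep) (word_act_cat rep)
    (word_act_inv rep) (word_act_rip rep)).
  move=> z; rewrite word_cat -[RHS](word_act_nil rep); apply: word_act_equiv.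
  by apply: word_equiv_relator; exists t.
have [w fix_w wv] := near_fixed_vector k2 (word_actB rep) (word_actZ rep) (word_act_inv rep)
   (word_act_rip rep) gap v.
have ev0 : 0 <= e * rnorm v by rewrite mulr_ge0 // ltW.
have sphere m : (m.+1 <= l)%N ->
    sphere_energy (word_act rep) m v <= (e * rnorm v) ^+ 2.
  move=> ml; apply: (sphere_energy_le k2) => x.
  rewrite -rnorm_sqr ler_pXn2r ?nnegrE ?rnorm_ge0 //.
  apply: le_trans (move_le x) _; rewrite size_tuple mulrA; apply: ler_wpM2r; first exact: ltW.
  by rewrite -le; apply: ler_wpM2r; [apply: ltW | rewrite ler_nat].
have E : Num.sqrt (energy (laplacian a b c (word_act rep)) v) <= 2 * (e * rnorm v).
  have -> : 2 * (e * rnorm v) = Num.sqrt ((2 * (e * rnorm v)) ^+ 2).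
    by rewrite sqrtr_sqr ger0_norm // mulr_ge0.
  rewrite ler_wsqrtr // exprMn.
  have := laplacian_energy a b c (word_act_rip rep) v.
  have := sphere a (leq_addr _ _).
  have := sphere b (leq_trans (leq_addr _ _) (leq_addl _ _)).
  have := sphere c (leq_trans (leq_addl _ _) (leq_addl _ _)).
  have := sqr_ge0 (e * rnorm v); lra.
have wv' : rnorm (w - v) <= 26 * (e * rnorm v) by lra.
have fix_len : forall x, size x = a.+1 -> reduced x -> word_act rep x w = w.
  by move=> x; apply: fix_w; rewrite mem_head.
have same := fixed_by_sphere k2 fix_len.
pose s0 : L := (Ordinal (ltnW k2), false).
pose w' := word_act rep [:: s0] w.
have sw s : word_act rep [:: s] w = w' by apply: same.
have sw' s : word_act rep [:: s] w' = w.
  rewrite -(sw (inv_letter s)) -{1}[s]inv_letterK.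
  exact: (word_act_inv rep [:: inv_letter s]).
(* The letters exchange w and w'. *)
exists (w + w'); last first.
  by apply: invariant_from_letters => s; rewrite word_actD sw sw' addrC.
apply/negP => /eqP ww'.
have w'E : w' = - w by apply/eqP; rewrite -addr_eq0 addrC ww'.
have h1 : rnorm v <= rnorm (v - w) + rnorm w by rewrite -{1}(subrK w v) rnormD.
have h2 : rnorm (w' - w) = 2 * rnorm w.
  rewrite w'E -opprD rnormN /rnorm -mulr2n -scaler_nat.
  have -> : 2%:R *: w = (2%:R : R)%:C *: w by rewrite rmorph_nat.
  by rewrite nsqZ sqrtrM ?sqr_ge0 // sqrtr_sqr ger0_norm.
have h3 : rnorm (w' - w) <= rnorm (word_act rep [:: s0] (w - v))
    + rnorm (word_act rep [:: s0] v - v) + rnorm (v - w).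
  have -> : w' - w = word_act rep [:: s0] (w - v) + (word_act rep [:: s0] v - v) + (v - w).
    by rewrite word_actB !subrKA.
  by apply: le_trans (rnormD _ _) _; rewrite lerD2r rnormD.
have := letters s0; have h4 : eps * rnorm v <= e * rnorm v by rewrite ler_pM2r.
rewrite rnorm_word_act (rnormBC v w) in h1 h3; nra.
Qed.
End PropertyT.

(** * Probability *)

Section Probability.
Variables (R : realType) (k : nat).
Hypothesis k2 : (2 <= k)%N.
Local Notation L := (letter k).
Local Notation q := (growth R k).

Lemma kernel_trace_ge0 (V : finType) (N : V -> V -> R) n :
  (forall u v, N u v = N v u) -> 0 <= kernel_trace (kernel_pow N (n + n)).
Proof.
move=> Nsym; apply: sumr_ge0 => u _; rewrite kernel_powD; apply: sumr_ge0 => w _.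
by rewrite (kernel_pow_sym n Nsym w u) -expr2 sqr_ge0.
Qed.

Lemma card_relator_le l : #|{: relator k l}|%:R <= (q + 1) ^+ l :> R.
Proof.
rewrite -(card_letter R k) -natrX ler_nat -card_tuple card_sig.
exact: max_card.
Qed.

Lemma binomial_prob_le1 (T : finType) (p : R) (P : {set T} -> Prop) :
  0 < p < 1 -> Defs.binomial_prob p P <= 1.
Proof.
move=> p01; rewrite -[leRHS](subset_weight_sum T p) [leRHS](bigID (fun A => `[< P A >])) /=.
by rewrite lerDl; apply: sumr_ge0 => A _; apply: subset_weight_ge0.
Qed.

(** The constant C of the theorem: the ratio that [expect_kernel_trace] and
    [norm_bound] leave, times 2 (q + 1) so that the resulting geometric factor
    also beats the number of all words of length l. *)
Definition threshold : R :=
  (72 * 2 * 9) * (24 * (q + 1)) ^+ 2 * q * (2 * (q + 1)).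

Lemma threshold_gt0 : 0 < threshold.
Proof.
have := growth_ge3 R k2 => q3; have q0 : 0 < q by lra.
have q1 : 0 < q + 1 by lra.
by rewrite /threshold !mulr_gt0 ?exprn_gt0 ?mulr_gt0 // ltr0n.
Qed.

Section Lengths.
Variables (a b c h : nat) (p : R).
Local Notation l := (a.+1 + (b.+1 + c.+1))%N.
Hypothesis p01 : 0 < p < 1.
Hypothesis h4 : (4 <= h)%N.
Hypothesis balanced : forall m, m \in [:: a; b; c] -> (h <= m.+1 <= h.+1)%N.
Hypothesis dense : threshold * l%:R * q ^+ h <= p * q ^+ l.

(** A norm of the deviation that [link_gap] tolerates for each of the three
    lengths. *)
Definition norm_bound : R := p * q ^+ l / (24 * (q + 1) * q ^+ h).
Definition degree_bound : R := 9 * q ^+ (l - h).+1 * p.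

Lemma norm_bound_gt0 : 0 < norm_bound.
Proof.
have q3 := growth_ge3 R k2; have q0 : 0 < q by lra.
have q1 : 0 < q + 1 by lra.
case/andP: p01 => p0 _.
by rewrite divr_gt0 ?mulr_gt0 ?exprn_gt0 // ltr0n.
Qed.

Lemma pow_large m : m \in [:: a; b; c] -> q + 1 <= 24^-1 * q ^+ m.+2.
Proof.
move=> /balanced/andP[hm _]; have q3 := growth_ge3 R k2; rewrite mulrC ler_pdivlMr ?ltr0n //.
apply: (@le_trans _ _ (q * 3 ^+ 4)).
  by rewrite -natrX; lra.
rewrite [leRHS]exprS; apply: ler_wpM2l; first lra.
apply: (@le_trans _ _ (3 ^+ m.+1)); first by apply: ler_weXn2l; [lra | lia].
by apply: lerXn2r; rewrite ?nnegrE //; lra.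
Qed.

Lemma norm_bound_ok m : m \in [:: a; b; c] ->
  norm_bound * q ^+ m <= 24^-1 * (p * (q ^+ 2 * q ^+ (a + b + c) / (q + 1))) * q.
Proof.
move=> /balanced/andP[_ mh]; have q3 := growth_ge3 R k2; have q0 : 0 < q by lra.
have qh : 0 < q ^+ h by rewrite exprn_gt0.
case/andP: p01 => p0 _.
have -> : 24^-1 * (p * (q ^+ 2 * q ^+ (a + b + c) / (q + 1))) * q = norm_bound * q ^+ h.
  rewrite /norm_bound.
  (* Equality holds for the length h + 1, hence the bound for shorter words. *)
  have -> : l = (a + b + c).+3 by lia.
  rewrite !exprS; field; rewrite !gt_eqF //; lra.
by apply: ler_wpM2l; [exact/ltW/norm_bound_gt0 | apply: ler_weXn2l; [lra | lia]].
Qed.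

Lemma in_degree_ok v :
  #|[set x : relator k l * 'I_9 | @link_tgt k a b c x.1 x.2 == v]|%:R * p
    <= degree_bound.
Proof.
case/andP: p01 => p0 _; apply: ler_wpM2r; first exact: ltW.
have q3 := growth_ge3 R k2; have q0 : 0 < q by lra.
have count m n : (m.+1 <= (l - h).+1)%N -> m = n -> q ^+ n.+1 / (q + 1) + 1 <= q ^+ (l - h).+1.
  move=> ml <-; have : q ^+ m.+1 <= q ^+ (l - h).+1 by apply: ler_weXn2l => //; lra.
  apply: le_trans.
  have : 3 <= q ^+ m.+1.
    apply: (le_trans q3); rewrite exprS -[leLHS]mulr1; apply: ler_wpM2l; first lra.
    by apply: exprn_ege1; lra.
  have : q ^+ m.+1 / (q + 1) <= q ^+ m.+1 / 2.
    apply: ler_wpM2l; first by rewrite exprn_ge0 // ltW.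
    by rewrite lef_pV2 ?posrE; lra.
  lra.
have ba := balanced (mem_head _ _).
have bb : (h <= b.+1 <= h.+1)%N by apply: balanced; rewrite !inE eqxx orbT.
have bc : (h <= c.+1 <= h.+1)%N by apply: balanced; rewrite !inE eqxx !orbT.
by apply: link_in_degree => //; apply: count erefl; lia.
Qed.

(** Markov's inequality for the trace of order 2m, where m is a power of two, as
    [kernel_form_le] needs, and lies between l and 2l: a larger exponent than l
    beats the number of words, and one of order l keeps m D small against D^2. *)
Lemma gromov_binomial_prob_ge :
  1 - 9 * 2^-1 ^+ l <= gromov_binomial_prob k l p (@property_T R).
Proof.
have q3 := growth_ge3 R k2; have q0 : 0 < q by lra.
have q1 : 0 < q + 1 by lra.
case/andP: (p01) => p0 p1.
have l0 : (0 < l)%N by [].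
pose j := (trunc_log 2 l).+1; pose m := (2 ^ j)%N.
have /andP[lm ml] : (l <= m <= 2 * l)%N.
  have /andP[t1 t2] := trunc_log_bounds (isT : 1 < 2)%N l0.
  by rewrite /m /j ltnW //= expnS leq_mul.
have lh : (h <= l)%N.
  by have := balanced (mem_head _ _); lia.
pose P := p * q ^+ (l - h).
have PE : p * q ^+ l = P * q ^+ h by rewrite /P -mulrA -exprD subnK.
have Pl : threshold * l%:R <= P.
  by rewrite -(ler_pM2r (exprn_gt0 h q0)) -PE.
have P0 : 0 < P by rewrite mulr_gt0 ?exprn_gt0.
have DE : degree_bound = 9 * q * P by rewrite /degree_bound /P exprS; ring.
have NE : norm_bound = P / (24 * (q + 1)).
  by rewrite /norm_bound PE; field; rewrite !gt_eqF ?exprn_gt0.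
have mlR : m%:R <= 2 * l%:R :> R by rewrite -natrM ler_nat.
have JD : (#|'I_9| * m.*2)%:R <= degree_bound.
  have t1 : 4 <= threshold.
    rewrite /threshold; apply: (@le_trans _ _ (1 * (2 * (q + 1)))); first lra.
    apply: ler_wpM2r; first lra.
    rewrite !mulr_ege1 ?exprn_ege1 //; lra.
  have l00 : 0 <= l%:R :> R by [].
  rewrite DE card_ord -mul2n !natrM; nra.
have small : (8 * #|'I_9| * m)%:R * degree_bound <= norm_bound ^+ 2 / (2 * (q + 1)).
  rewrite ler_pdivlMr ?mulr_gt0 // NE DE card_ord !natrM.
  apply: (@le_trans _ _ (8 * 9 * (2 * l%:R) * (9 * q * P) * (2 * (q + 1)))).
    apply: ler_wpM2r; first lra.
    by have := mulr_gt0 q0 P0 => qP; apply: ler_wpM2r; lra.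
  rewrite exprMn exprVn ler_pdivlMr ?exprn_gt0 ?mulr_gt0 //.
  rewrite expr2; apply: le_trans (ler_wpM2r (ltW P0) Pl).
  rewrite /threshold; move: (l%:R : R) => x; lra.
have mean := @expect_kernel_trace R _ _ _ (@link_src k a b c) (@link_tgt k a b c) (@link_coef R) p
  (@link_coef_le1 R) p01 m degree_bound.
have I9 : (0 < #|'I_9|)%N by rewrite card_ord.
have m0 : (0 < m)%N by rewrite expn_gt0.
have {}mean := mean m0 I9 JD in_degree_ok.
have T0 := card_relator_le l.
pose y : R := (2 * (q + 1))^-1.
have y0 : 0 < y by rewrite invr_gt0 mulr_gt0.
have y1 : y <= 1 by rewrite invf_le1 ?mulr_gt0 //; lra.
have tail : (#|{: relator k l}| * #|'I_9|)%:R * p * ((8 * #|'I_9| * m)%:R * degree_bound) ^+ m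
    <= 9 * 2^-1 ^+ l * norm_bound ^+ m.*2.
  have D0 : 0 <= degree_bound by apply: le_trans JD.
  have s1 : ((8 * #|'I_9| * m)%:R * degree_bound) ^+ m <= norm_bound ^+ m.*2 * y ^+ l.
    apply: (@le_trans _ _ ((norm_bound ^+ 2 * y) ^+ m)).
      apply: lerXn2r => //; rewrite nnegrE; first by rewrite mulr_ge0.
      by apply: mulr_ge0; [apply: sqr_ge0 | apply: ltW].
    rewrite exprMn -exprM mul2n; apply: ler_wpM2l.
      by rewrite exprn_ge0 // ltW // norm_bound_gt0.
    by apply: ler_wiXn2l => //; apply: ltW.
  have s2 : (#|{: relator k l}| * #|'I_9|)%:R * p <= 9 * (q + 1) ^+ l.
    rewrite natrM card_ord -[leRHS]mulr1 [9 * _]mulrC; apply: ler_pM => //; last exact: ltW.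
      by rewrite ltW.
    by apply: ler_wpM2r.
  apply: (@le_trans _ _ (9 * (q + 1) ^+ l * (norm_bound ^+ m.*2 * y ^+ l))).
    by apply: ler_pM => //; [rewrite mulr_ge0 // ltW | rewrite exprn_ge0 // mulr_ge0].
  have -> : 2^-1 = (q + 1) * y by rewrite /y; field; rewrite gt_eqF.
  rewrite [((q + 1) * y) ^+ l]exprMn.
  move: ((q + 1) ^+ l) (y ^+ l) (norm_bound ^+ m.*2) => x z t.
  by have -> : 9 * x * (t * z) = 9 * (x * z) * t by ring.
have e0 : 0 < norm_bound ^+ m.*2 by rewrite exprn_gt0 // norm_bound_gt0.
have F0 (A : {set relator k l}) : 0 <= kernel_trace (kernel_pow (link_kernel A p) m.*2).
  by rewrite -addnn; apply: kernel_trace_ge0 => u v; apply: link_kernel_sym.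
apply: le_trans (expect_markov p01 e0 F0 (le_trans mean tail)) _.
rewrite /gromov_binomial_prob /Defs.binomial_prob big_mkcond [leRHS]big_mkcond /=.
apply: ler_sum => A _; case: ifP => FA; last by case: ifP => // _; apply: subset_weight_ge0.
rewrite ifT //; apply/asboolP.
apply: (@property_T_of_trace R k a b c k2 A p norm_bound j p0 norm_bound_gt0).
- by apply: pow_large; rewrite mem_head.
- by apply: pow_large; rewrite !inE eqxx orbT.
- by apply: pow_large; rewrite !inE eqxx !orbT.
- exact: norm_bound_ok.
by rewrite expnS mul2n ltW.
Qed.

End Lengths.
End Probability.

(** The three lengths are l/3, (l+1)/3 and (l+2)/3, rounded down.  The hypothesis
    on p only improves when l/3 is rounded down in the exponent. *)
Lemma gromov_binomial_prob_large (R : realType) (k l : nat) (p : R) : (2 <= k)%N ->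
  0 < p < 1 -> (12 <= l)%N ->
  threshold R k * l%:R * (2 * k%:R - 1) `^ (l%:R / 3) / (2 * k%:R - 1) ^+ l <= p ->
  1 - 9 * 2^-1 ^+ l <= gromov_binomial_prob k l p (@property_T R).
Proof.
move=> k2 p01 l12; rewrite -/(growth R k) => dense.
pose h := (l %/ 3)%N; pose b := ((l.+1) %/ 3).-1; pose c := ((l.+2) %/ 3).-1.
have q3 := growth_ge3 R k2.
have powh : growth R k ^+ h <= growth R k `^ (l%:R / 3).
  rewrite -powR_mulrn; last lra.
  apply: ler_powR; first lra.
  by rewrite ler_pdivlMr // -natrM ler_nat /h leq_trunc_div.
have {}dense : threshold R k * l%:R * growth R k ^+ h <= p * growth R k ^+ l.
  have ql : 0 < growth R k ^+ l by rewrite exprn_gt0 //; lra.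
  rewrite ler_pdivrMr // in dense; apply: le_trans dense; apply: ler_wpM2l => //.
  by rewrite mulr_ge0 // ltW // threshold_gt0.
have lE : l = (h.-1.+1 + (b.+1 + c.+1))%N by rewrite /h /b /c; lia.
have bal : forall m, m \in [:: h.-1; b; c] -> (h <= m.+1 <= h.+1)%N.
  by move=> m; rewrite !inE => /or3P[]/eqP ->; rewrite /h /b /c; lia.
have h4 : (4 <= h)%N by rewrite /h; lia.
have := @gromov_binomial_prob_ge R k k2 h.-1 b c h p p01 h4 bal.
by rewrite -lE; apply.
Qed.

Local Open Scope classical_set_scope.

Theorem theorem12p6 (R : realType) (k : nat) (hk : (2 <= k)%N) :
  exists C : R, 0 < C /\
    forall rho : nat -> R,
      (forall l : nat, 0 < rho l < 1) ->
      (\forall l \near \oo,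
         rho l >= C * l%:R * (2 * k%:R - 1) `^ (l%:R / 3) / (2 * k%:R - 1) ^+ l) ->
      gromov_binomial_prob k l (rho l) (@property_T R) @[l --> \oo] --> (1 : R).
Proof.
exists (threshold R k); split; first exact: threshold_gt0.
move=> rho rho01 dense.
have tail : (1 - 9 * 2^-1 ^+ l : R) @[l --> \oo] --> (1 : R).
  rewrite -[X in _ --> X]subr0 -[X in _ --> _ - X](mulr0 9).
  apply: cvgB; first exact: cvg_cst.
  apply: cvgM; first exact: cvg_cst.
  by apply: cvg_expr; rewrite ger0_norm ?invr_ge0 // invf_lt1 // ltr1n.
apply: squeeze_cvgr tail (cvg_cst _).
have l12 : \forall l \near \oo, (12 <= l)%N by exists 12.
near=> l; apply/andP; split; last exact: binomial_prob_le1.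
apply: gromov_binomial_prob_large => //; by near: l.
Unshelve. all: by end_near.
Qed.
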